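(* Let $n\ge 3$, let $1\le p<\infty$ and $\frac1p+\frac1q=1$, and let $\gamma\in\mathbf{R}$ satisfy $$-(n-1)(p-1)<\gamma<(n-1)+p \quad\text{if } p>1;\qquad 0<\gamma\le n\quad\text{if } p=1.$$ Let $0<\alpha\le n$. Let $f$ be a measurable function on $\mathbf{R}^{n-1}$ satisfying $$\int_{\mathbf{R}^{n-1}}\frac{|f(y')|^p}{(1+|y'|)^{\gamma}}\,dy'<\infty,$$ and let $v$ be the harmonic function on $H$ defined by the Poisson integral $$v(x)=\int_{\mathbf{R}^{n-1}}P(x,y')f(y')\,dy',\qquad x\in H.$$ Then there exist an at most countable (finite or infinite) family of points $x_j\in H$ and radii $\rho_j>0$, $j=1,2,\dots$, such that $$\sum_{j}\frac{\rho_j^{pn-\alpha}}{|x_j|^{pn-\alpha}}<\infty$$ and, with $G=\bigcup_{j}B(x_j,\rho_j)$, $$v(x)=o\left(x_n^{1-\frac{\alpha}{p}}|x|^{\frac{\gamma}{p}+\frac{n-1}{q}-n+\frac{\alpha}{p}}\right)\quad\text{as } |x|\to\infty,\ x\in H\setminus G.$$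
   Context: Points of $\mathbf{R}^n$ are written $x=(x',x_n)$ with $x'\in\mathbf{R}^{n-1}$, $x_n\in\mathbf{R}$; $|\cdot|$ is the Euclidean norm. $H=\{x=(x',x_n)\in\mathbf{R}^n: x_n>0\}$ is the upper half space, with boundary $\partial H$ identified with $\mathbf{R}^{n-1}$ (i.e. with $\mathbf{R}^{n-1}\times\{0\}$). $B(x,\rho)$ is the open ball in $\mathbf{R}^n$ of center $x$ and radius $\rho$. The Poisson kernel of $H$ is $$P(x,y')=\frac{2x_n}{\omega_n|x-(y',0)|^n},\qquad x\in H,\ y'\in\mathbf{R}^{n-1},$$ where $\omega_n=\frac{2\pi^{n/2}}{\Gamma(n/2)}$ is the surface area of the unit sphere in $\mathbf{R}^n$. When $p=1$ one has $q=\infty$ and $\frac{n-1}{q}$ is read as $0$. The statement $v(x)=o(g(x))$ as $|x|\to\infty$, $x\in H\setminus G$, means: for every $\varepsilon>0$ there is $R>0$ such that $|v(x)|\le\varepsilon g(x)$ for all $x\in H\setminus G$ with $|x|\ge R$. *)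

(* Defs.v *)
From HB Require Import structures.
From mathcomp Require Import all_boot all_order all_algebra.
From mathcomp Require Import all_classical all_reals all_analysis.

Set Implicit Arguments.
Unset Strict Implicit.
Unset Printing Implicit Defensive.
Import Order.TTheory GRing.Theory Num.Theory.
Import numFieldNormedType.Exports.

Local Open Scope classical_set_scope.
Local Open Scope ring_scope.

(* The sigma-algebra generated by the coordinates, i.e. the Borel sets of R^m. *)
Section borel_rV.
Context {R : realType} (m : nat).

Definition coord_rV (i : 'I_m) (v : 'rV[R]_m) : R := v ord0 i.

Let rV_set0 : g_sigma_preimage coord_rV set0.
Proof. exact: sigma_algebra0. Qed.

Let rV_setC A : g_sigma_preimage coord_rV A -> g_sigma_preimage coord_rV (~` A).
Proof. exact: sigma_algebraC. Qed.

Let rV_bigcup (F : (set 'rV[R]_m)^nat) :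
  (forall i, g_sigma_preimage coord_rV (F i)) ->
  g_sigma_preimage coord_rV (\bigcup_i F i).
Proof. exact: sigma_algebra_bigcup. Qed.

HB.instance Definition _ := @isMeasurable.Build default_measure_display
  'rV[R]_m (g_sigma_preimage coord_rV) rV_set0 rV_setC rV_bigcup.

End borel_rV.

Lemma measurable_coord_rV (R : realType) m (i : 'I_m) :
  measurable_fun [set: 'rV[R]_m] (coord_rV i).
Proof.
move=> _ Y mY; rewrite setTI; apply: sub_sigma_algebra => /=.
rewrite -bigcup_seq/=; exists i => /=; first by rewrite mem_index_enum.
by exists Y => //; rewrite setTI.
Qed.

Lemma measurable_fun_rVP d (T : measurableType d) (R : realType) m
    (f : T -> 'rV[R]_m) :
  (forall i, measurable_fun [set: T] (fun t => f t ord0 i)) ->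
  measurable_fun [set: T] f.
Proof.
move=> mf.
suff : @measurable _ 'rV[R]_m `<=` [set A | measurable (f @^-1` A)].
  by move=> H _ A mA; rewrite setTI; exact: H.
apply: smallest_sub.
  split => [|A mA|F mF] /=.
  - by rewrite preimage_set0.
  - by rewrite setTD preimage_setC; exact: measurableC.
  - by rewrite preimage_bigcup; apply: bigcup_measurable => k _; exact: mF.
rewrite -bigcup_seq => A [i _ [B mB <-]] /=.
by rewrite setTI -comp_preimage -[X in measurable X]setTI; exact: mf.
Qed.

(* Lebesgue measure on the Borel sets of R^m: lebesgue_measure, m-fold product. *)
Section lebesgue_step.
Context {R : realType} (m : nat).
Variable mu : {sigma_finite_measure set 'rV[R]_m -> \bar R}.

Definition cons_rV (z : R * 'rV[R]_m) : 'rV[R]_m.+1 :=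
  row_mx (z.1%:M : 'rV_1) z.2.

Let behead_rV (v : 'rV[R]_m.+1) : R * 'rV[R]_m :=
  (v ord0 ord0, rsubmx (v : 'rV_(1 + m))).

Let cons_rVK : cancel cons_rV behead_rV.
Proof.
move=> [t y]; rewrite /behead_rV /cons_rV /= row_mxKr; congr pair.
transitivity ((t%:M : 'M[R]_1) ord0 ord0); last by rewrite mxE eqxx mulr1n.
by rewrite -[RHS](row_mxEl _ y); congr (fun_of_matrix _ _ _); exact/val_inj.
Qed.

Let measurable_cons_rV : measurable_fun setT cons_rV.
Proof.
apply: measurable_fun_rVP => i.
have [j ->|j ->] := split_ordP (i : 'I_(1 + m)).
- rewrite (_ : (fun _ => _) = fst); first exact: measurable_fst.
  apply/funext => z; apply: (etrans (row_mxEl _ _ _ _)).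
  by rewrite mxE !ord1 eqxx mulr1n.
- rewrite (_ : (fun _ => _) = coord_rV j \o snd).
    by apply: measurableT_comp => //; exact: measurable_coord_rV.
  by apply/funext => z; exact: (row_mxEr _ _ _ _).
Qed.

Let measurable_behead_rV : measurable_fun setT behead_rV.
Proof.
apply: measurable_fun_pair; first exact: measurable_coord_rV.
apply: measurable_fun_rVP => i.
rewrite (_ : (fun _ => _) = coord_rV (rshift 1 i)).
  exact: measurable_coord_rV.
by apply/funext => v; rewrite mxE.
Qed.

Definition lebesgue_step : set 'rV[R]_m.+1 -> \bar R :=
  pushforward (lebesgue_measure \x mu)%E cons_rV.

Let lebesgue_step0 : lebesgue_step set0 = 0%E.
Proof. by rewrite /lebesgue_step /pushforward preimage_set0 measure0. Qed.

Let lebesgue_step_ge0 A : (0 <= lebesgue_step A)%E.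
Proof. exact: measure_ge0. Qed.

Let lebesgue_step_sigma_additive : semi_sigma_additive lebesgue_step.
Proof.
exact: measure_semi_sigma_additive.
Qed.

HB.instance Definition _ := isMeasure.Build _ _ _ lebesgue_step
  lebesgue_step0 lebesgue_step_ge0 lebesgue_step_sigma_additive.

Let lebesgue_step_sigma_finite : sigma_finite setT lebesgue_step.
Proof.
have /sigma_finiteP[F [TF ndF Foo]] := sigma_finiteT (@lebesgue_measure R).
have /sigma_finiteP[G [TG ndG Goo]] := sigma_finiteT mu.
exists (fun k => behead_rV @^-1` (F k `*` G k)).
  rewrite -preimage_bigcup (_ : \bigcup_k _ = setT) ?preimage_setT//.
  rewrite -subTset => -[t y] _.
  have [i _ Fit] : (\bigcup_k F k) t by rewrite -TF.
  have [j _ Gjy] : (\bigcup_k G k) y by rewrite -TG.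
  exists (maxn i j) => //; split => /=.
  - by move: t Fit; exact/subsetPset/ndF/leq_maxl.
  - by move: y Gjy; exact/subsetPset/ndG/leq_maxr.
move=> k; have [mFk ?] := Foo k; have [mGk ?] := Goo k; split.
  by rewrite -[X in measurable X]setTI; apply: measurable_behead_rV => //;
    exact: measurableX.
rewrite /lebesgue_step /pushforward -comp_preimage.
rewrite (_ : behead_rV \o cons_rV = id) ?preimage_id; last first.
  by apply/funext => z; exact: cons_rVK.
by rewrite product_measure1E// lte_mul_pinfty// ge0_fin_numE.
Qed.

HB.instance Definition _ := @Measure_isSigmaFinite.Build _ _ _ lebesgue_step
  lebesgue_step_sigma_finite.

End lebesgue_step.

Fixpoint borel_lebesgue (R : realType) (m : nat) :
    {sigma_finite_measure set 'rV[R]_m -> \bar R} :=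
  match m with
  | 0 => \d_(0 : 'rV[R]_0)
  | k.+1 => lebesgue_step (borel_lebesgue R k)
  end.

(* R^m with its Lebesgue measurable sets, and Lebesgue measure on them, i.e. the
   completion of [borel_lebesgue]. *)
Definition lebesgueType (R : realType) (m : nat) :=
  caratheodory_type (mu_ext (borel_lebesgue R m)).

HB.instance Definition _ (R : realType) (m : nat) :=
  Measurable.on (lebesgueType R m).

Definition lebesgue_rV (R : realType) (m : nat) :
    set (lebesgueType R m) -> \bar R :=
  @completed_measure_extension _ _ _ (borel_lebesgue R m).

HB.instance Definition _ (R : realType) (m : nat) :=
  Measure.on (@lebesgue_rV R m).

Section half_space.
Context {R : realType}.

(* The library norm on row vectors is the sup norm. *)
Definition enorm m (x : 'rV[R]_m) : R := Num.sqrt (\sum_(i < m) x ord0 i ^+ 2).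

Definition eball m (c : 'rV[R]_m) (r : R) : set 'rV[R]_m :=
  [set x | enorm (x - c) < r].

Definition euler_gamma (s : R) : R :=
  \int[lebesgue_measure]_(t in `]0, +oo[) (t `^ (s - 1) * expR (- t)).

Definition sphere_area (n : nat) : R :=
  2 * pi `^ (n%:R / 2) / euler_gamma (n%:R / 2).

(* R^n is represented, for n >= 1, as 'rV_(n.-1 + 1), so that x = (x', x_n) with
   x' = lsubmx x and x_n = height x, and (y', 0) = row_mx y' 0. *)
Definition height n (x : 'rV[R]_(n.-1 + 1)) : R := rsubmx x ord0 ord0.

Definition upper_half_space n : set 'rV[R]_(n.-1 + 1) := [set x | 0 < height x].

Definition poisson_kernel n (x : 'rV[R]_(n.-1 + 1)) (y : 'rV[R]_n.-1) : R :=
  2 * height x / (sphere_area n * enorm (x - row_mx y 0) ^+ n).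

Definition poisson_integral n (f : 'rV[R]_n.-1 -> R)
    (x : 'rV[R]_(n.-1 + 1)) : R :=
  \int[@lebesgue_rV R n.-1]_y (poisson_kernel x y * f y).

Definition little_o_at_infinity m (A : set 'rV[R]_m) (v g : 'rV[R]_m -> R) :=
  forall eps : R, 0 < eps -> exists2 r : R, 0 < r &
    forall x, A x -> r <= enorm x -> `|v x| <= eps * g x.

End half_space.

(* Main.v *)
Require Import Defs.
From mathcomp Require Import all_boot all_order all_algebra.
From mathcomp Require Import finmap.
From mathcomp Require Import all_classical all_reals all_analysis.
From mathcomp Require Import measurable_realfun ring lra.
Set Implicit Arguments.
Unset Strict Implicit.
Unset Printing Implicit Defensive.
Import Order.TTheory GRing.Theory Num.Theory.
Import numFieldNormedType.Exports.
Local Open Scope classical_set_scope.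
Local Open Scope ring_scope.

(** Write [N = n - 1], [F = |f|], [s = |y'|], [r = |x|], [t = x_n], and
[beta = gamma / p + N (1 - 1/p)].  The Poisson kernel is at most a constant
times [t |x - y'|^-n], so the theorem amounts to the bound
[I(x) = o(t^(-alpha/p) r^(beta - n + alpha/p))] for the potential
[I(x)], the integral of [F |x - y'|^-n], off the exceptional balls.  All
estimates use the sup norm of row vectors; passing to the Euclidean norm costs
constant factors, which are absorbed in the radii and in the little o.

The hypothesis says that [g = F^p (1 + s)^-gamma] has finite integral.  In
place of the Hoelder inequality the proof uses the pointwise inequality
[a <= u + u^(1-p) a^p] ([le_addr_powR]), where [u] is a positive function of
[y'] chosen region by region: the integral of [u] is the desired bound and, as
[F^p = g (1 + s)^gamma], the other term is controlled by the integral of [g].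
It covers [p = 1] together with [p > 1].  The domain of integration is split
according to the size of [s].

- For [s <= r/2] one has [|x - y'|^-n <= (r/2)^-n].  The function [u] is a
  multiple of [(1 + s)^(-N + delta)], which is summable up to [r] at the rate
  [r^delta] ([integral_inner_le]); the lower bound on [gamma], in the form
  [0 < beta], makes the remaining power of [(1 + s)/r] positive, so that the
  bounded part of [g] contributes little.
- For [s >= 2r] the power [|x - y'|^-n] is at most [4^n (1 + s)^-n] and [u] is a
  multiple of [(1 + s)^(-N - delta)]; the upper bound on [gamma] lets the tail
  of [g] control the other term ([integral_outer_le]).
- For [r/2 < s < 2r] the function [u] is constant and what remains is the
  integral of [g |x - y'|^(-pn)].  Cut into dyadic shells, it is controlled as
  soon as the mass of [g] in the ball of radius [rho] around [x] is at most
  [eta (rho/r)^(pn - alpha)] for every [rho] ([integral_near_le]).  The series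
  of shells starts at [rho = t], since [|x - y'| >= t], and converges because
  [alpha > 0].

The exceptional balls cover the points at which this last condition fails.  A
Vitali selection ([vitali_covering]) extracts disjoint balls whose
enlargements cover those points, and disjointness bounds the sum of
[(rho/r)^(pn - alpha)] by the mass of [g] at distance comparable to [r] or
larger, divided by [eta].  Letting [eta] decrease to 0 along shells
[R_k <= |x| < R_(k+1)] with [R_k] so large that the mass beyond [R_k / 2] is
much smaller than the [k]-th value of [eta], the total is finite
([exceptional_balls]).

The estimates hold in any measure space with a map [e] to a normed space such
that the preimage of the ball of radius [rho] about the origin has measure at
most [(2 rho)^N]; Lebesgue measure enters only through this bound. *)

(** * Powers and dyadic scales *)

(** Writing positive bases as exponentials turns an identity between products of
powers into a linear identity between exponents. *)
Lemma gt0_expR (R : realType) (x : R) : 0 < x -> exists l, x = expR l.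
Proof. by move=> x0; exists (ln x); rewrite lnK. Qed.

Lemma mulr_regroup (R : comPzRingType) (c x y z u v w g : R) :
  x * y * z = u * (v * w) -> c * x * y * (g * z) = c * u * (v * w * g).
Proof.
move=> E; transitivity (c * g * (x * y * z)); first by ring.
by rewrite E; ring.
Qed.

Lemma powR_lt1 (R : realType) (x a : R) : 0 <= x -> x < 1 -> 0 < a ->
  x `^ a < 1.
Proof.
move=> x0 x1 a0; have : x `^ a < 1 `^ a by apply: gt0_ltr_powR; rewrite ?nnegrE.
by rewrite powR1.
Qed.

Lemma powR_opp_lt1 (R : realType) (x a : R) : 1 < x -> 0 < a ->
  x `^ (- a) < 1.
Proof.
move=> x1 a0; have x0 := lt_trans ltr01 x1.
rewrite powRN -(powR_inv1 (powR_ge0 _ _)) powRAC powR_inv1 ?ltW//.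
by apply: powR_lt1; rewrite ?invr_ge0 ?ltW ?invf_lt1 ?ltW.
Qed.

Lemma half_lt1 (R : realType) : 2^-1 < 1 :> R.
Proof. by rewrite invf_lt1// ltr1n. Qed.

Lemma mulr_regroup_le (R : numDomainType) (c x y z w u g : R) : 0 <= c -> 0 <= g ->
  x * y * (z * w) <= u -> c * x * y * (g * z * w) <= c * u * g.
Proof.
move=> c0 g0 xyz; have -> : c * x * y * (g * z * w) = c * (x * y * (z * w)) * g.
  by ring.
by rewrite ler_wpM2r// ler_wpM2l.
Qed.

(** Either [a <= t], or [a = a^(1-p) a^p] with [a^(1-p) <= t^(1-p)].  This takes
the place of the Hoelder inequality, the free parameter [t] being allowed to
depend on the point of integration. *)
Lemma le_addr_powR (R : realType) (p a t : R) : 1 <= p -> 0 <= a -> 0 < t ->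
  a <= t + t `^ (1 - p) * a `^ p.
Proof.
move=> p1 a0 t0; have [at_|ta] := leP a t.
  by apply: le_trans at_ _; rewrite lerDl mulr_ge0// powR_ge0.
have agt0 : 0 < a by exact: lt_trans ta.
apply: (@le_trans _ _ (t `^ (1 - p) * a `^ p)); last by rewrite lerDr ltW.
have -> : a `^ p = a * a `^ (p - 1).
  by rewrite mulr_powRB1// (lt_le_trans ltr01).
rewrite mulrCA ler_peMr// -[1 - p]opprB powRN mulrC ler_pdivlMr ?powR_gt0// mul1r.
by apply: ge0_ler_powR; rewrite ?subr_ge0// ?nnegrE ltW.
Qed.

Lemma powR_le_norm (R : realType) (M x a : R) : 0 < M -> M^-1 <= x -> x <= M ->
  x `^ a <= M `^ `|a|.
Proof.
move=> M0 Mx xM; have x0 : 0 < x by apply: lt_le_trans Mx; rewrite invr_gt0.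
have [a0|a0] := leP 0 a.
  by rewrite ger0_norm//; apply: ge0_ler_powR; rewrite ?nnegrE// ltW.
rewrite ltr0_norm// -{1}[a]opprK powRN -powR_inv1 ?powR_ge0// powRAC.
rewrite powR_inv1 ?(ltW x0)//.
apply: ge0_ler_powR; rewrite ?nnegrE ?invr_ge0 ?(ltW x0) ?(ltW M0) ?oppr_ge0 ?(ltW a0)//.
by rewrite -[leRHS]invrK lef_pV2 ?posrE ?invr_gt0.
Qed.

(** The exponent may be negative, whence the two-sided comparison. *)
Lemma powR_le_comparable (R : realType) (M a b s : R) : 0 < M -> 0 < b ->
  a <= M * b -> b <= M * a -> a `^ s <= M `^ `|s| * b `^ s.
Proof.
move=> M0 b0 ab ba; have a0 : 0 < a by rewrite -(pmulr_rgt0 _ M0) (lt_le_trans b0).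
have -> : a `^ s = (a / b) `^ s * b `^ s.
  by rewrite -powRM ?divr_ge0 ?(ltW a0) ?(ltW b0)// divfK// gt_eqF.
rewrite ler_wpM2r ?powR_ge0//; apply: powR_le_norm => //.
  by rewrite ler_pdivlMr// mulrC ler_pdivrMr// mulrC.
by rewrite ler_pdivrMr.
Qed.

Lemma dyadic_above (R : realType) (r h : R) : 0 < r -> r <= h ->
  exists k, 2 ^+ k * r <= h < 2 ^+ k * (2 * r).
Proof.
move=> r0 rh.
have ex : exists k, h < 2 ^+ k * (2 * r).
  exists (Num.truncn (h / (2 * r))).+1.
  rewrite -ltr_pdivrMr ?mulr_gt0//; apply: lt_trans (truncnS_gt _) _.
  by rewrite -natrX ltr_nat ltn_expl.
case: (ex_minnP ex) => k hk kmin; exists k; rewrite hk andbT.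
case: k hk kmin => [|k] _ kmin; first by rewrite expr0 mul1r.
have -> : 2 ^+ k.+1 * r = 2 ^+ k * (2 * r) by rewrite exprS; ring.
rewrite leNgt; apply/negP => /kmin; by rewrite ltnn.
Qed.

Lemma dyadic_below (R : realType) (r h : R) : 0 < h -> h < 2 * r ->
  exists k, 2^-1 ^+ k * r <= h < 2^-1 ^+ k * (2 * r).
Proof.
move=> h0 hr.
have ex : exists k, 2^-1 ^+ k * r <= h.
  exists (Num.truncn (r / h)).+1.
  rewrite exprVn mulrC ler_pdivrMr ?exprn_gt0// mulrC -ler_pdivrMr//.
  apply: le_trans (ltW (truncnS_gt _)) _.
  by rewrite -natrX ler_nat ltnW// ltn_expl.
case: (ex_minnP ex) => k hk kmin; exists k; rewrite hk /=.
case: k hk kmin => [|k] _ kmin; first by rewrite expr0 mul1r.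
have -> : 2^-1 ^+ k.+1 * (2 * r) = 2^-1 ^+ k * r by rewrite exprS; field.
rewrite ltNge; apply/negP => /kmin; by rewrite ltnn.
Qed.

(** * Series and sums over countable families *)

Lemma nneseries_geometric_le (R : realType) (c x : R) : 0 <= c -> 0 <= x < 1 ->
  (\sum_(k <oo) (c * x ^+ k)%:E <= (c / (1 - x))%:E)%E.
Proof.
move=> c0 /andP[x0 x1]; apply: lime_le.
  by apply: is_cvg_nneseries => k _ _; rewrite lee_fin mulr_ge0// exprn_ge0.
apply: nearW => n; rewrite sumEFin lee_fin -mulr_sumr ler_wpM2l//.
rewrite -[leRHS]mul1r ler_pdivlMr ?subr_gt0// mulrC big_mkord.
by rewrite -opprB mulNr -subrX1 opprB gerBl exprn_ge0.
Qed.

(** Only finitely many terms exceed [1/(n+1)], for each [n]. *)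
Lemma esum_lty_countable (R : realType) (I : choiceType) (D : set I)
    (a : I -> R) : (forall i, D i -> 0 < a i) ->
  (\esum_(i in D) (a i)%:E < +oo)%E -> countable D.
Proof.
move=> a0 soo.
have -> : D = \bigcup_n [set i | D i /\ n.+1%:R^-1 <= a i].
  apply/seteqP; split=> [i Di|i [n _ []]//].
  have ai0 := a0 _ Di.
  exists (Num.truncn (a i)^-1) => //; split => //.
  rewrite -[leRHS]invrK lef_pV2 ?posrE ?invr_gt0 ?ltr0n//.
  by rewrite ltW// truncnS_gt.
apply: bigcup_countable => // n _; apply: finite_set_countable.
set A := [set i | _]; apply: contrapT => iA.
have s0 : (0 <= \esum_(i in D) (a i)%:E)%E.
  by apply: esum_ge0 => i /a0 /ltW; rewrite lee_fin.
move: soo s0; case E : (\esum_(i in D) _)%E => [s||]// _; rewrite lee_fin => s0.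
have [B BA cB] := infinite_set_fset (Num.truncn (n.+1%:R * s)).+1 iA.
have : (\esum_(i in D) (a i)%:E >= (\sum_(i \in [set` B]) (a i)%:E))%E.
  apply: ereal_sup_ubound; exists [set` B] => //; split => //.
  by move=> i /BA [].
rewrite E fsbig_finite//= set_fsetK sumEFin lee_fin leNgt => /negP; apply.
have : (size B)%:R * n.+1%:R^-1 <= \sum_(i <- B) a i.
  rewrite mulr_natl -[leLHS]addr0 -iter_addr -(count_predT B) -big_const_seq.
  by rewrite !big_seq; apply: ler_sum => i /BA [].
apply: lt_le_trans.
rewrite ltr_pdivlMr ?ltr0n// mulrC (lt_le_trans (truncnS_gt _))//.
by rewrite ler_nat.
Qed.

Lemma esum_scale_lty (R : realType) (I : choiceType) (D : set I) (a : I -> R)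
    (c : R) : 0 <= c -> (forall i, D i -> 0 <= a i) ->
  (\esum_(i in D) (a i)%:E < +oo)%E -> (\esum_(i in D) (c * a i)%:E < +oo)%E.
Proof.
move=> c0 a0 soo.
have s0 : (0 <= \esum_(i in D) (a i)%:E)%E.
  by apply: esum_ge0 => i /a0; rewrite lee_fin.
apply: (@le_lt_trans _ _ (c%:E * \esum_(i in D) (a i)%:E)%E); last first.
  by apply: lte_mul_pinfty => //; rewrite ge0_fin_numE.
apply: ge_ereal_sup => _ /= [X [finX XD] <-].
rewrite fsbig_finite//=; under eq_bigr do rewrite EFinM.
rewrite big_seq -ge0_sume_distrr; last first.
  by move=> i; rewrite in_fset_set// inE => /XD /a0; rewrite lee_fin.
apply: lee_wpmul2l; rewrite ?lee_fin// -big_seq.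
by apply: ereal_sup_ubound; exists X => //; rewrite fsbig_finite.
Qed.

(** * Integrals of nonnegative functions *)

Section level_sets.
Context d (T : measurableType d) (R : realType) (h : T -> R).
Hypothesis mh : measurable_fun setT h.

Lemma measurable_lt_cst c : measurable [set y | h y < c].
Proof.
have := mh measurableT (measurable_itv `]-oo, c[); rewrite setTI.
by congr measurable; apply/seteqP; split=> y /=; rewrite in_itv.
Qed.

Lemma measurable_gt_cst c : measurable [set y | c < h y].
Proof.
have := mh measurableT (measurable_itv `]c, +oo[); rewrite setTI.
by congr measurable; apply/seteqP; split=> y /=; rewrite in_itv/= andbT.
Qed.

Lemma measurable_le_cst c : measurable [set y | h y <= c].
Proof.
have := mh measurableT (measurable_itv `]-oo, c]); rewrite setTI.
by congr measurable; apply/seteqP; split=> y /=; rewrite in_itv.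
Qed.

Lemma measurable_ge_cst c : measurable [set y | c <= h y].
Proof.
have := mh measurableT (measurable_itv `[c, +oo[); rewrite setTI.
by congr measurable; apply/seteqP; split=> y /=; rewrite in_itv/= andbT.
Qed.

Lemma measurable_fun_powR a : measurable_fun setT (fun y => h y `^ a).
Proof. exact: measurableT_comp (measurable_powR a) mh. Qed.

End level_sets.

Section integral_bounds.
Context d (T : measurableType d) (R : realType).
Variable mu : {measure set T -> \bar R}.

Lemma ge0_integral_le_add (D : set T) (f u w : T -> R) (a b : R) :
  measurable D -> measurable_fun setT f -> measurable_fun setT u ->
  measurable_fun setT w -> (forall y, 0 <= f y) -> (forall y, 0 <= u y) ->
  (forall y, 0 <= w y) -> (forall y, D y -> f y <= u y + w y) ->
  (\int[mu]_(y in D) (u y)%:E <= a%:E)%E ->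
  (\int[mu]_(y in D) (w y)%:E <= b%:E)%E ->
  (\int[mu]_(y in D) (f y)%:E <= (a + b)%:E)%E.
Proof.
move=> mD mf mu' mw f0 u0 w0 fuw ua wb.
apply: (@le_trans _ _ (\int[mu]_(y in D) ((u y)%:E + (w y)%:E))%E).
  apply: ge0_le_integral => //.
  - by move=> y _; rewrite lee_fin.
  - by apply/measurable_EFinP; exact: measurable_funTS.
  - by apply: emeasurable_funD; apply/measurable_EFinP; exact: measurable_funTS.
rewrite ge0_integralD//; first by rewrite EFinD; exact: leeD.
- by move=> y _; rewrite lee_fin.
- by apply/measurable_EFinP; exact: measurable_funTS.
- by move=> y _; rewrite lee_fin.
- by apply/measurable_EFinP; exact: measurable_funTS.
Qed.

Lemma ge0_integral_le_scale (D : set T) (f : T -> R) (c a : R) :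
  measurable D -> measurable_fun setT f -> (forall y, 0 <= f y) -> 0 <= c ->
  (\int[mu]_(y in D) (f y)%:E <= a%:E)%E ->
  (\int[mu]_(y in D) (c * f y)%:E <= (c * a)%:E)%E.
Proof.
move=> mD mf f0 c0 fa; under eq_integral do rewrite EFinM.
rewrite ge0_integralZl ?lee_fin//.
- by rewrite EFinM; apply: lee_wpmul2l; rewrite ?lee_fin.
- by apply/measurable_EFinP; exact: measurable_funTS.
- by move=> y _; rewrite lee_fin.
Qed.

Lemma ge0_integral_indic_le (D A : set T) (f : T -> R) :
  measurable D -> measurable A -> measurable_fun setT f ->
  (forall y, 0 <= f y) ->
  (\int[mu]_(y in D) (f y * \1_A y)%:E <= \int[mu]_(y in A) (f y)%:E)%E.
Proof.
move=> mD mA mf f0.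
rewrite (_ : (fun y => (f y * \1_A y)%:E) = (EFin \o f) \_ A); last first.
  apply/funext => y; rewrite patchE indicE; case: ifPn => _.
    by rewrite mulr1.
  by rewrite mulr0.
rewrite -integral_mkcondr; apply: ge0_subset_integral => //.
- exact: measurableI.
- by apply/measurable_EFinP; exact: measurable_funTS.
- by move=> y _; rewrite lee_fin.
Qed.

Lemma ge0_integral_le_subset (D A : set T) (f : T -> R) (a : R) :
  measurable D -> measurable A -> measurable_fun setT f ->
  (forall y, 0 <= f y) -> D `<=` A ->
  (\int[mu]_(y in A) (f y)%:E <= a%:E)%E ->
  (\int[mu]_(y in D) (f y)%:E <= a%:E)%E.
Proof.
move=> mD mA mf f0 DA; apply: le_trans; apply: ge0_subset_integral => //.
- by apply/measurable_EFinP; exact: measurable_funTS.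
- by move=> y _; rewrite lee_fin.
Qed.

Lemma ge0_integral_le_ptwise (D : set T) (f u : T -> R) (a : R) :
  measurable D -> measurable_fun setT f -> measurable_fun setT u ->
  (forall y, 0 <= f y) -> (forall y, D y -> f y <= u y) ->
  (\int[mu]_(y in D) (u y)%:E <= a%:E)%E ->
  (\int[mu]_(y in D) (f y)%:E <= a%:E)%E.
Proof.
move=> mD mf mu' f0 fu; apply: le_trans; apply: ge0_le_integral => //.
- by move=> y _; rewrite lee_fin.
- by apply/measurable_EFinP; exact: measurable_funTS.
- by apply/measurable_EFinP; exact: measurable_funTS.
Qed.

End integral_bounds.

Lemma ge0_integral_le_split d (T : measurableType d) (R : realType)
    (mu : {measure set T -> \bar R}) (D A : set T) (f : T -> R) (a b : R) :
  measurable D -> measurable A -> measurable_fun setT f ->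
  (forall y, 0 <= f y) ->
  (\int[mu]_(y in D `&` A) (f y)%:E <= a%:E)%E ->
  (\int[mu]_(y in D `\` A) (f y)%:E <= b%:E)%E ->
  (\int[mu]_(y in D) (f y)%:E <= (a + b)%:E)%E.
Proof.
move=> mD mA mf f0 ha hb; rewrite -[in leLHS](setUIDK D A).
rewrite ge0_integral_setU//.
- by rewrite EFinD; exact: leeD.
- exact: measurableI.
- exact: measurableD.
- by apply/measurable_EFinP; exact: measurable_funTS.
- by move=> y _; rewrite lee_fin.
- by rewrite disj_set2E; apply/eqP/seteqP; split=> y // [[_ Ay] [_]].
Qed.

Lemma normr_Rintegral_le d (T : measurableType d) (R : realType)
    (mu : {measure set T -> \bar R}) (f : T -> R) (a : R) :
  measurable_fun setT f -> (\int[mu]_y `|f y|%:E <= a%:E)%E ->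
  `|\int[mu]_y f y| <= a.
Proof.
move=> mf fa; have : (`|\int[mu]_y (f y)%:E| <= a%:E)%E.
  apply: le_trans fa; apply: le_trans (le_abse_integral _ _ _) _ => //.
  exact/measurable_EFinP.
rewrite /Rintegral; case: (\int[mu]_y (f y)%:E)%E => [r||] //=.
Qed.

Section integrals.
Context d (T : measurableType d) (R : realType).
Variable mu : {measure set T -> \bar R}.

(** A growth condition on the mass of [g] in the sublevel sets of [h] at the
scales [theta^k r] bounds the integral of [g h^-a], by comparison with a
geometric series.  With [theta = 2] this handles large values of [h] when
[b < a], and with [theta = 1/2] small values of [h] when [a < b]. *)
Lemma integral_shells_le (D : set T) (g h : T -> R) (theta r a b K : R) :
  measurable D -> measurable_fun setT g -> measurable_fun setT h ->
  (forall y, 0 <= g y) -> 0 < theta -> 0 < r -> 0 <= a -> 0 <= K ->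
  theta `^ (b - a) < 1 ->
  (forall y, D y -> exists k, theta ^+ k * r <= h y < theta ^+ k * (2 * r)) ->
  (forall k, \int[mu]_(y in D `&` [set y | (h y < theta ^+ k * (2 * r))%R]) (g y)%:E
     <= (K * (theta ^+ k * (2 * r)) `^ b)%:E)%E ->
  (\int[mu]_(y in D) (g y * h y `^ (- a))%:E <=
   (K * 2 `^ b * r `^ (b - a) / (1 - theta `^ (b - a)))%:E)%E.
Proof.
move=> mD mg mh g0 th0 r0 a0 K0 th1 Dk H.
pose A k := [set y | h y < theta ^+ k * (2 * r)].
have mA k : measurable (A k) by exact: measurable_lt_cst.
pose u k := (fun y => ((theta ^+ k * r) `^ (- a) * g y)%:E) \_ (A k).
have u0 k y : (0 <= u k y)%E.
  by apply: erestrict_ge0 => z _; rewrite lee_fin mulr_ge0// powR_ge0.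
have mu_ k : measurable_fun D (u k).
  apply: (measurable_funS measurableT) => //.
  apply/(measurable_restrictT _ (mA k)).1/measurable_EFinP.
  by apply: measurable_funTS; exact: measurable_funM.
apply: (@le_trans _ _ (\int[mu]_(y in D) \sum_(k <oo) u k y)%E).
  apply: ge0_le_integral => //.
  - by move=> y _; rewrite lee_fin mulr_ge0// powR_ge0.
  - apply/measurable_EFinP; apply: measurable_funTS.
    by apply: measurable_funM => //; exact: measurable_fun_powR.
  - by apply: ge0_emeasurable_sum => // k y _ _; exact: u0.
  - move=> y /[dup] Dy /Dk[k /andP[h1 h2]].
    rewrite (@nneseriesD1 _ _ k)//.
    apply: (@le_trans _ _ (u k y)); last first.
      by rewrite leeDl// nneseries_ge0.
    rewrite /u patchE mem_set// lee_fin mulrC ler_wpM2r//.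
    rewrite !powRN lef_pV2 ?posrE ?powR_gt0 ?mulr_gt0 ?exprn_gt0//; last first.
      by apply: lt_le_trans h1; rewrite mulr_gt0 ?exprn_gt0.
    apply: ge0_ler_powR => //; rewrite nnegrE ?mulr_ge0 ?exprn_ge0 ?ltW//.
    by apply: lt_le_trans h1; rewrite mulr_gt0 ?exprn_gt0.
rewrite integral_nneseries//.
apply: (@le_trans _ _ (\sum_(k <oo) ((K * 2 `^ b * r `^ (b - a)) *
    (theta `^ (b - a)) ^+ k)%:E)%E); last first.
  by apply: nneseries_geometric_le; rewrite ?mulr_ge0 ?powR_ge0.
apply: lee_nneseries => [k _ _|k _]; first exact: integral_ge0.
rewrite /u -integral_mkcondr.
under eq_integral do rewrite EFinM.
rewrite ge0_integralZl ?lee_fin ?powR_ge0//; last 3 first.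
- exact: measurableI.
- by apply/measurable_EFinP; exact: measurable_funTS.
- by move=> y _; rewrite lee_fin.
apply: (@le_trans _ _ (((theta ^+ k * r) `^ (- a))%:E *
  (K * (theta ^+ k * (2 * r)) `^ b)%:E)%E).
  by apply: lee_wpmul2l; [rewrite lee_fin powR_ge0|exact: H].
rewrite -EFinM lee_fin.
have [lt eth] := gt0_expR th0; have [lr er] := gt0_expR r0.
have [l2 e2] := gt0_expR (ltr0n R 2).
rewrite le_eqVlt; apply/orP; left; apply/eqP.
rewrite e2 eth er -!expRM -!expRM_natl -!expRD -!expRM mulrCA -!mulrA -!expRD.
by congr (K * expR _); ring.
Qed.

(** Dominated convergence applied to the restrictions of [g] to [n < h]. *)
Lemma integral_tail_le (g h : T -> R) (e : R) :
  measurable_fun setT g -> measurable_fun setT h -> (forall y, 0 <= g y) ->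
  (\int[mu]_y (g y)%:E < +oo)%E -> 0 < e ->
  exists H, forall H', H <= H' ->
    (\int[mu]_(y in [set y | (H' < h y)%R]) (g y)%:E <= e%:E)%E.
Proof.
move=> mg mh g0 goo e0.
pose A n := [set y | n%:R < h y].
have mA n : measurable (A n) by exact: measurable_gt_cst.
have ig : mu.-integrable setT (EFin \o g).
  apply/integrableP; split; first exact/measurable_EFinP.
  by under eq_integral do rewrite gee0_abs ?lee_fin//.
have [||||_ _] := @dominated_convergence _ _ _ mu setT measurableT
    (fun n => (EFin \o g) \_ (A n)) (cst 0%E) (EFin \o g) _ _ _ ig.
- move=> n; apply/(measurable_restrictT _ (mA n)).1.
  by apply: measurable_funTS; exact/measurable_EFinP.
- exact: measurable_cst.
- apply: aeW => y _.
  apply: cvg_near_cst; exists (Num.truncn `|h y|).+1 => // n /= hn.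
  rewrite patchE memNset// /A /= => nh.
  have : `|h y| < n%:R by apply: lt_le_trans (truncnS_gt _) _; rewrite ler_nat.
  by rewrite ltNge => /negP; apply; rewrite (le_trans (ltW nh))// ler_norm.
- apply: aeW => y n _; rewrite /= patchE; case: ifPn => _ /=.
    by rewrite ger0_norm.
  by rewrite normr0 lee_fin.
rewrite integral_cst// mul0e => /fine_cvgP[fin cvg].
have /(_ _ e e0) := (cvgr0Pnorm_lt _).1 cvg.
move=> {}cvg; near \oo => n; exists n%:R => H' nH'.
apply: (@le_trans _ _ (\int[mu]_(y in A n) (g y)%:E)%E).
  apply: ge0_subset_integral => //.
  - exact: measurable_gt_cst.
  - by apply/measurable_EFinP; exact: measurable_funTS.
  - by move=> y _; rewrite lee_fin.
  - by move=> y /=; exact: le_lt_trans.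
rewrite integral_mkcond /=.
have /= fn : (\int[mu]_y ((EFin \o g) \_ (A n)) y)%E \is a fin_num by near: n.
have /= en : `|fine (\int[mu]_y ((EFin \o g) \_ (A n)) y)%E| < e by near: n.
rewrite -(fineK fn) lee_fin; apply: le_trans (ltW en).
exact: ler_norm.
Unshelve. all: by end_near. Qed.

End integrals.

(** * Potentials of weighted functions *)

(** The relation [betaE] makes [beta], when it is positive, the order of growth
in [r] that the Hoelder inequality gives for the integral of [F] over
[s < r]. *)
Section weighted_function.
Context d (T : measurableType d) (R : realType).
Variables (mu : {measure set T -> \bar R}) (s F : T -> R) (N p gamma beta : R).
Hypotheses (N0 : 0 < N) (p1 : 1 <= p) (betaE : p * beta = gamma + N * (p - 1)).
Hypotheses (ms : measurable_fun setT s) (s0 : forall y, 0 <= s y).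
Hypotheses (mF : measurable_fun setT F) (F0 : forall y, 0 <= F y).
Hypothesis vol : forall rho, 0 < rho ->
  (mu [set y | (s y < rho)%R] <= ((2 * rho) `^ N)%:E)%E.

Local Notation h := (fun y => 1 + s y).
Local Notation g := (fun y => F y `^ p * (1 + s y) `^ (- gamma)).

Hypothesis goo : (\int[mu]_y (g y)%:E < +oo)%E.

Let p0 : 0 < p. Proof. exact: lt_le_trans p1. Qed.
Let pN0 : p != 0. Proof. by rewrite gt_eqF. Qed.
Let h0 y : 0 < 1 + s y. Proof. by rewrite ltr_wpDr. Qed.
Let mh : measurable_fun setT h. Proof. exact: measurable_funD. Qed.
Let mg : measurable_fun setT g.
Proof.
apply: measurable_funM; first exact: measurable_fun_powR.
exact: (@measurable_fun_powR _ _ _ h).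
Qed.
Let g0 y : 0 <= g y. Proof. by rewrite mulr_ge0 ?powR_ge0. Qed.

Let Fg y : F y `^ p = g y * (1 + s y) `^ gamma.
Proof. by rewrite -mulrA -powRD ?addNr ?powRr0 ?mulr1// implybE (gt_eqF (h0 y)) orbT. Qed.

Let volh rho : 0 < rho ->
  (\int[mu]_(y in [set y | (1 + s y < rho)%R]) (cst 1 y)%:E
    <= ((2 * rho) `^ N)%:E)%E.
Proof.
move=> rho0; rewrite (integral_cst mu _ 1%E); last exact: measurable_lt_cst.
rewrite mul1e; apply: le_trans (vol rho0); apply: le_measure.
- by apply: mem_set; exact: measurable_lt_cst.
- by apply: mem_set; exact: measurable_lt_cst.
- by move=> y /=; apply: le_lt_trans; rewrite lerDr.
Qed.

Lemma integral_weight_below (delta r : R) : 0 < delta <= N -> 0 < r ->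
  (\int[mu]_(y in [set y | (1 + s y < 2 * r)%R]) (h y `^ (- (N - delta)))%:E <=
    (2 `^ N * 2 `^ N * r `^ delta / (1 - 2^-1 `^ delta))%:E)%E.
Proof.
move=> /andP[de0 deN] r0.
have NE : delta = N - (N - delta) by rewrite subKr.
have := @integral_shells_le _ _ _ mu [set y | 1 + s y < 2 * r] (cst 1) h
   2^-1 r (N - delta) N (2 `^ N).
rewrite -NE; under eq_integral do rewrite mul1r.
apply => //; rewrite ?invr_gt0 ?subr_ge0 ?powR_ge0//.
- exact: measurable_lt_cst.
- by apply: powR_lt1; rewrite ?half_lt1.
- by move=> y /= yr; exact: dyadic_below.
- move=> k; have k0 : 0 < 2^-1 ^+ k * (2 * r) by rewrite !mulr_gt0 ?exprn_gt0.
  rewrite -powRM ?(ltW k0)//.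
  apply: ge0_integral_le_subset (volh k0) => //.
  + by apply: measurableI; exact: measurable_lt_cst.
  + exact: measurable_lt_cst.
Qed.

Lemma integral_weight_above (delta r : R) : 0 < delta -> 0 < r ->
  (\int[mu]_(y in [set y | (r <= 1 + s y)%R]) (h y `^ (- (N + delta)))%:E <=
    (2 `^ N * 2 `^ N * r `^ (- delta) / (1 - 2 `^ (- delta)))%:E)%E.
Proof.
move=> de0 r0.
have NE : - delta = N - (N + delta) by rewrite opprD addrA subrr add0r.
have := @integral_shells_le _ _ _ mu [set y | r <= 1 + s y] (cst 1) h
   2 r (N + delta) N (2 `^ N).
rewrite -NE; under eq_integral do rewrite mul1r.
apply => //; rewrite ?addr_ge0 ?powR_ge0 ?ltW//.
- exact: measurable_ge_cst.
- by apply: powR_opp_lt1; rewrite ?ltr1n.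
- by move=> y /= yr; exact: dyadic_above.
- move=> k; have k0 : 0 < 2 ^+ k * (2 * r) by rewrite !mulr_gt0 ?exprn_gt0.
  rewrite -powRM ?(ltW k0)//.
  apply: ge0_integral_le_subset (volh k0) => //.
  + by apply: measurableI; [exact: measurable_ge_cst|exact: measurable_lt_cst].
  + exact: measurable_lt_cst.
Qed.

Let finM : exists2 M, 0 <= M & (\int[mu]_y (g y)%:E <= M%:E)%E.
Proof.
have i0 : (0 <= \int[mu]_y (g y)%:E)%E.
  by apply: integral_ge0 => y _; rewrite lee_fin.
exists (fine (\int[mu]_y (g y)%:E)%E); first exact: fine_ge0.
by rewrite fineK// ge0_fin_numE.
Qed.

(** The comparison function is
[eta r^(beta - delta) (1 + s)^(-(N - delta))].  It leaves the factor
[((1 + s) / r)^kappa] in front of [g], with [kappa > 0]: this factor is at most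
[zeta] where [1 + s <= H1] once [r] is large, and at most [2^kappa] elsewhere,
where the integral of [g] is at most [tau]. *)
Lemma integral_inner_le (e : R) : 0 < beta -> 0 < e ->
  exists2 r0, 1 <= r0 & forall r, r0 <= r ->
    (\int[mu]_(y in [set y | (1 + s y < 2 * r)%R]) (F y)%:E
      <= (e * r `^ beta)%:E)%E.
Proof.
move=> b0 e0; have [M M0 gM] := finM.
(* [delta <= N] keeps the exponent of [1 + s] nonpositive and
   [delta <= beta] makes [kappa] positive. *)
pose delta := Num.min N beta.
have /andP[de0 deN] : 0 < delta <= N by rewrite lt_min N0 b0 ge_min lexx.
have deb : delta <= beta by rewrite ge_min lexx orbT.
pose kappa := p * beta - delta * (p - 1).
have ka0 : 0 < kappa.
  have -> : kappa = p * (beta - delta) + delta by rewrite /kappa; ring.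
  by rewrite ltr_wpDl// mulr_ge0 ?subr_ge0// ltW.
pose C := 2 `^ N * 2 `^ N / (1 - 2^-1 `^ delta).
have C0 : 0 < C.
  rewrite divr_gt0 ?mulr_gt0 ?powR_gt0// subr_gt0.
  by apply: powR_lt1; rewrite ?half_lt1.
have [eta eta0 etaE] : exists2 eta, 0 < eta & eta * C = e / 2.
  exists (e / (2 * C)); first by apply: divr_gt0 => //; exact: mulr_gt0.
  by field; rewrite gt_eqF.
have : 0 < eta `^ (1 - p) by rewrite powR_gt0.
set c := eta `^ (1 - p) => c0.
have [zeta zeta0 zetaE] : exists2 z, 0 < z & c * z * (M + 1) = e / 4.
  exists (e / (4 * c * (M + 1))); first by rewrite divr_gt0 ?mulr_gt0 ?ltr_wpDl.
  by field; rewrite !gt_eqF// ltr_wpDl.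
have [tau tau0 tauE] : exists2 z, 0 < z & c * 2 `^ kappa * z = e / 4.
  exists (e / (4 * c * 2 `^ kappa)).
    by rewrite divr_gt0 ?mulr_gt0 ?powR_gt0.
  by field; rewrite !gt_eqF ?powR_gt0.
have [H Htail] := @integral_tail_le _ _ _ mu g h tau mg mh g0 goo tau0.
pose H1 := Num.max H 1.
have H10 : 0 < H1 by rewrite lt_max ltr01 orbT.
exists (Num.max 1 (H1 / zeta `^ kappa^-1)); first by rewrite le_max lexx.
move=> r; rewrite ge_max => /andP[r1 rH].
have r0 : 0 < r by exact: lt_le_trans r1.
have mD : measurable [set y | 1 + s y < 2 * r] by exact: measurable_lt_cst.
have mA : measurable [set y | H1 < 1 + s y] by exact: measurable_gt_cst.
have H1r : (H1 / r) `^ kappa <= zeta.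
  rewrite -[leRHS](powRr1 (ltW zeta0)) -(mulVf (lt0r_neq0 ka0)) powRrM.
  apply: ge0_ler_powR; rewrite ?nnegrE ?powR_ge0 ?divr_ge0 ?(ltW H10) ?(ltW r0)//.
    exact: ltW.
  by rewrite ler_pdivrMr// mulrC -ler_pdivrMr ?powR_gt0.
apply: (@le_trans _ _ (eta * r `^ (beta - delta) * (C * r `^ delta) +
   (c * r `^ beta) * (zeta * M + 2 `^ kappa * tau))%:E); last first.
  have -> : eta * r `^ (beta - delta) * (C * r `^ delta) = eta * C * r `^ beta.
    by rewrite mulrACA -powRD ?subrK// implybE (gt_eqF r0) orbT.
  rewrite lee_fin [c * _ * _]mulrAC -mulrDl ler_wpM2r ?powR_ge0//.
  have : 0 <= c * zeta by rewrite mulr_ge0// ltW.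
  lra.
have gA : (\int[mu]_(y in [set y | (1 + s y < 2 * r)%R])
    (g y * \1_[set y | (H1 < 1 + s y)%R] y)%:E <=
    tau%:E)%E.
  apply: le_trans (Htail H1 _); last by rewrite le_max lexx.
  exact: ge0_integral_indic_le.
have gD : (\int[mu]_(y in [set y | (1 + s y < 2 * r)%R]) (g y)%:E <= M%:E)%E.
  exact: ge0_integral_le_subset gM.
have m1 : measurable_fun setT (\1_[set y | H1 < 1 + s y] : T -> R).
  exact: measurable_indic.
have i0 y : 0 <= \1_[set y | H1 < 1 + s y] y :> R by rewrite indicE ler0n.
apply: (@ge0_integral_le_add _ _ _ mu _ _
  (fun y => eta * r `^ (beta - delta) * h y `^ (- (N - delta)))
  (fun y => (c * r `^ beta) * (zeta * g y +
      2 `^ kappa * (g y * \1_[set y | H1 < 1 + s y] y)))) => //.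
- apply: measurable_funM => //; exact: (@measurable_fun_powR _ _ _ h).
- apply: measurable_funM => //; apply: measurable_funD.
    exact: measurable_funM.
  by apply: measurable_funM => //; exact: measurable_funM.
- by move=> y; rewrite !mulr_ge0 ?powR_ge0// ltW.
- by move=> y; rewrite !(mulr_ge0, addr_ge0, powR_ge0)// ltW.
- move=> y /= yr.
  have T0 : 0 < eta * r `^ (beta - delta) * (1 + s y) `^ (- (N - delta)).
    by rewrite !mulr_gt0 ?powR_gt0.
  apply: le_trans (le_addr_powR p1 (F0 y) T0) _; rewrite lerD2l {1}Fg.
  have [lr er] := gt0_expR r0; have [lh eh] := gt0_expR (h0 y).
  have -> : (eta * r `^ (beta - delta) * (1 + s y) `^ (- (N - delta))) `^ (1 - p) *
     (g y * (1 + s y) `^ gamma) = c * r `^ beta * (((1 + s y) / r) `^ kappa * g y).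
    move: (g y) => G.
    rewrite !powRM ?invr_ge0 ?mulr_ge0 ?powR_ge0 ?(ltW eta0) ?(ltW r0) ?(ltW (h0 y))//.
    rewrite -/c er eh -!expRN -!expRM.
    have E : expR (lr * (beta - delta) * (1 - p)) *
        expR (lh * - (N - delta) * (1 - p)) * expR (lh * gamma) =
        expR (lr * beta) * (expR (lh * kappa) * expR (- lr * kappa)).
      rewrite -!expRD; congr expR.
      have -> : gamma = p * beta - N * (p - 1) by rewrite betaE addrK.
      by rewrite /kappa; ring.
    exact: mulr_regroup E.
  rewrite ler_wpM2l ?mulr_ge0 ?powR_ge0 ?(ltW c0)//.
  rewrite [X in _ <= X](_ : _ = (zeta + 2 `^ kappa *
    \1_[set y | H1 < 1 + s y] y) * g y); last by rewrite /=; ring.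
  rewrite ler_wpM2r//; have [hH|Hh] := leP (1 + s y) H1.
    apply: (@le_trans _ _ zeta); last by rewrite lerDl mulr_ge0 ?powR_ge0.
    apply: le_trans H1r; apply: ge0_ler_powR; rewrite ?nnegrE ?(ltW ka0)//.
    - by rewrite divr_ge0// ltW.
    - by rewrite divr_ge0// ltW.
    - by rewrite ler_pM2r ?invr_gt0.
  rewrite indicE mem_set// mulr1; apply: (@le_trans _ _ (2 `^ kappa)); last first.
    by rewrite lerDr ltW.
  apply: ge0_ler_powR; rewrite ?nnegrE ?(ltW ka0)//.
    by rewrite divr_ge0// ltW.
  by rewrite ler_pdivrMr// ltW.
- apply: ge0_integral_le_scale => //.
  + exact: (@measurable_fun_powR _ _ _ h).
  + by move=> y; rewrite powR_ge0.
  + by rewrite mulr_ge0 ?powR_ge0// ltW.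
  + by rewrite mulrAC; apply: integral_weight_below => //; rewrite de0.
- apply: ge0_integral_le_scale => //.
  + apply: measurable_funD; first exact: measurable_funM.
    by apply: measurable_funM => //; exact: measurable_funM.
  + by move=> y; rewrite !(mulr_ge0, addr_ge0, powR_ge0)// ltW.
  + by rewrite mulr_ge0 ?powR_ge0// ltW.
  apply: (@ge0_integral_le_add _ _ _ mu _ _ (fun y => zeta * g y)
    (fun y => 2 `^ kappa * (g y * \1_[set y | H1 < 1 + s y] y))) => //.
  + apply: measurable_funD; first exact: measurable_funM.
    by apply: measurable_funM => //; exact: measurable_funM.
  + exact: measurable_funM.
  + by apply: measurable_funM => //; exact: measurable_funM.
  + by move=> y; rewrite !(mulr_ge0, addr_ge0, powR_ge0)// ltW.
  + by move=> y; rewrite !(mulr_ge0, addr_ge0, powR_ge0)// ltW.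
  + by move=> y; rewrite !(mulr_ge0, addr_ge0, powR_ge0)// ltW.
  + by apply: ge0_integral_le_scale => //; rewrite ltW.
  + apply: ge0_integral_le_scale; rewrite ?powR_ge0//.
      exact: measurable_funM.
    by move=> y; rewrite !(mulr_ge0, powR_ge0).
Qed.

(** The comparison function is
[eta r^(beta - n + delta) (1 + s)^(-(N + delta))].  The hypothesis on [delta]
says that the power of [1 + s] left in front of [g] is nonpositive, hence
largest at [1 + s = r]. *)
Lemma integral_outer_le (n delta e : R) : 0 < delta ->
  p * (beta - n) + delta * (p - 1) <= 0 -> 0 < e ->
  exists2 r0, 1 <= r0 & forall r, r0 <= r ->
    (\int[mu]_(y in [set y | (r <= 1 + s y)%R]) (F y * h y `^ (- n))%:E
      <= (e * r `^ (beta - n))%:E)%E.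
Proof.
move=> de0 kap e0.
pose C := 2 `^ N * 2 `^ N / (1 - 2 `^ (- delta)).
have C0 : 0 < C.
  rewrite divr_gt0 ?mulr_gt0 ?powR_gt0// subr_gt0.
  by apply: powR_opp_lt1; rewrite ?ltr1n.
have [eta eta0 etaE] : exists2 eta, 0 < eta & eta * C = e / 2.
  exists (e / (2 * C)); first by apply: divr_gt0 => //; exact: mulr_gt0.
  by field; rewrite gt_eqF.
have : 0 < eta `^ (1 - p) by rewrite powR_gt0.
set c := eta `^ (1 - p) => c0.
have [tau tau0 tauE] : exists2 z, 0 < z & c * z = e / 2.
  exists (e / (2 * c)); first by rewrite divr_gt0 ?mulr_gt0.
  by field; rewrite !gt_eqF.
have [H Htail] := @integral_tail_le _ _ _ mu g h tau mg mh g0 goo tau0.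
exists (Num.max 1 (H + 1)); first by rewrite le_max lexx.
move=> r; rewrite ge_max => /andP[r1 rH].
have r0 : 0 < r by exact: lt_le_trans r1.
have mD : measurable [set y | r <= 1 + s y] by exact: measurable_ge_cst.
have mhn a : measurable_fun setT (fun y => h y `^ a).
  exact: (@measurable_fun_powR _ _ _ h).
have -> : e * r `^ (beta - n) = eta * r `^ (beta - n + delta) *
    (C * r `^ (- delta)) + (c * r `^ (beta - n)) * tau.
  rewrite mulrACA -powRD ?addrK; last by rewrite implybE (gt_eqF r0) orbT.
  by rewrite etaE [c * _ * tau]mulrAC tauE -mulrDl -splitr.
apply: (@ge0_integral_le_add _ _ _ mu _ _
  (fun y => eta * r `^ (beta - n + delta) * h y `^ (- (N + delta)))
  (fun y => (c * r `^ (beta - n)) * g y)) => //.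
- exact: measurable_funM.
- exact: measurable_funM.
- exact: measurable_funM.
- by move=> y; rewrite mulr_ge0 ?powR_ge0.
- by move=> y; rewrite !mulr_ge0 ?powR_ge0// ltW.
- by move=> y; rewrite mulr_ge0 ?g0// mulr_ge0 ?powR_ge0// ltW.
- move=> y /= yr.
  have T0 : 0 < eta * r `^ (beta - n + delta) * (1 + s y) `^ (- (N + delta)).
    by rewrite !mulr_gt0 ?powR_gt0.
  have f0 : 0 <= F y * (1 + s y) `^ (- n) by rewrite mulr_ge0 ?powR_ge0.
  apply: le_trans (le_addr_powR p1 f0 T0) _.
  rewrite lerD2l powRM ?powR_ge0// {1}Fg.
  have := h0 y; have := g0 y; move: (g y) => G G0 hy0.
  have [lr er] := gt0_expR r0; have [lh eh] := gt0_expR hy0.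
  have lrh : lr <= lh by rewrite -ler_expR -er -eh.
  rewrite !powRM ?mulr_ge0 ?powR_ge0 ?(ltW eta0)// -/c er eh -!expRM.
  apply: mulr_regroup_le; rewrite ?(ltW c0)// -!expRD ler_expR -subr_ge0.
  have -> : gamma = p * beta - N * (p - 1) by rewrite betaE addrK.
  suff : 0 <= (lh - lr) * - (p * (beta - n) + delta * (p - 1)) by lra.
  by rewrite mulr_ge0 ?subr_ge0// oppr_ge0.
- apply: ge0_integral_le_scale => //.
  + by move=> y; rewrite powR_ge0.
  + by rewrite mulr_ge0 ?powR_ge0// ltW.
  + by rewrite mulrAC; exact: integral_weight_above.
- apply: ge0_integral_le_scale => //.
  + by rewrite mulr_ge0 ?powR_ge0// ltW.
  + apply: ge0_integral_le_subset (Htail H (lexx _)) => //.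
    * exact: measurable_gt_cst.
    * by move=> y /=; apply: lt_le_trans; apply: lt_le_trans rH; rewrite ltrDl.
Qed.

(** The comparison function is the constant [U] for which [U r^N] is the desired
bound, up to a numerical factor.  The integral of [g dist^(-pn)]
is summed over the shells [2^k t <= dist < 2^(k+1) t]; it is the exponent
[-alpha], left over from [(pn - alpha) - pn], that makes the series
converge. *)
Lemma integral_near_le (n alpha r t eta : R) (dist : T -> R) :
  0 < alpha <= p * n -> 1 <= r -> 0 < t -> 0 < eta ->
  measurable_fun setT dist -> (forall y, t <= dist y) ->
  (forall rho, 0 < rho ->
    (\int[mu]_(y in [set y | (r / 2 < s y)%R /\ (dist y < rho)%R]) (g y)%:E
      <= (eta `^ p * (rho / r) `^ (p * n - alpha))%:E)%E) ->
  (\int[mu]_(y in [set y | (r / 2 < s y)%R /\ (s y < 2 * r)%R])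
      (F y * dist y `^ (- n))%:E <=
    ((4 `^ N + 3 `^ `|gamma| * (2 `^ (p * n - alpha) / (1 - 2 `^ (- alpha)))) *
      (eta * (t `^ (- (alpha / p)) * r `^ (beta - n + alpha / p))))%:E)%E.
Proof.
move=> /andP[al0 aln] r1 t0 eta0 md dt good.
have r0 : 0 < r by exact: lt_le_trans r1.
have mA : measurable [set y | r / 2 < s y /\ s y < 2 * r].
  by apply: measurableI; [exact: measurable_gt_cst|exact: measurable_lt_cst].
set Theta := _ * r `^ _.
have Th0 : 0 < Theta by rewrite mulr_gt0 ?powR_gt0.
have mdn a : measurable_fun setT (fun y => dist y `^ a).
  exact: measurable_fun_powR.
have d0 y : 0 < dist y by exact: lt_le_trans (dt y).
pose U := eta * Theta * r `^ (- N).
have U0 : 0 < U by rewrite !mulr_gt0 ?powR_gt0.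
pose W := U `^ (1 - p) * (3 `^ `|gamma| * r `^ gamma).
have W0 : 0 < W by rewrite !mulr_gt0 ?powR_gt0.
have th1 : 0 < 1 - 2 `^ (- alpha) :> R.
  by rewrite subr_gt0; apply: powR_opp_lt1; rewrite ?ltr1n.
have -> : (4 `^ N + 3 `^ `|gamma| * (2 `^ (p * n - alpha) / (1 - 2 `^ (- alpha)))) *
   (eta * Theta) = U * (4 * r) `^ N + W * (eta `^ p * r `^ (alpha - p * n) *
     2 `^ (p * n - alpha) * t `^ (- alpha) / (1 - 2 `^ (- alpha))).
  rewrite mulrDl; congr (_ + _).
    rewrite /U powRM ?(ltW r0)// powRN; field.
    by rewrite gt_eqF ?powR_gt0.
  have E : eta * Theta = U `^ (1 - p) * r `^ gamma * (eta `^ p *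
      r `^ (alpha - p * n) * t `^ (- alpha)).
    have [lr er] := gt0_expR r0; have [lt et] := gt0_expR t0.
    have [le ee] := gt0_expR eta0.
    rewrite /U /Theta er et ee -!expRM -!expRD -expRM -!expRD; congr expR.
    have -> : gamma = p * beta - N * (p - 1) by rewrite betaE addrK.
    by field.
  rewrite /W E; ring.
apply: (@ge0_integral_le_add _ _ _ mu _ _ (cst U)
  (fun y => W * (g y * dist y `^ (- (p * n))))) => //.
- exact: measurable_funM.
- by apply: measurable_funM => //; exact: measurable_funM.
- by move=> y; rewrite mulr_ge0 ?powR_ge0.
- by move=> y; rewrite ltW.
- by move=> y; apply: mulr_ge0; [exact: ltW|rewrite mulr_ge0 ?powR_ge0].
- move=> y /= [yr1 yr2].
  have f0 : 0 <= F y * dist y `^ (- n) by rewrite mulr_ge0 ?powR_ge0.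
  apply: le_trans (le_addr_powR p1 f0 U0) _; rewrite lerD2l.
  rewrite /W powRM ?powR_ge0// -mulrA ler_wpM2l ?powR_ge0// -powRrM {1}Fg.
  rewrite mulNr (mulrC n) mulrA; apply: ler_wpM2r; first exact: powR_ge0.
  rewrite mulrC; apply: ler_wpM2r => //.
  by apply: powR_le_comparable => //; lra.
- rewrite (integral_cst mu mA U%:E) [X in (_ <= X)%E]EFinM; apply: lee_wpmul2l.
    by rewrite lee_fin ltW.
  have -> : 4 * r = 2 * (2 * r) by ring.
  apply: le_trans (vol _); last by rewrite mulr_gt0.
  apply: le_measure; [exact: mem_set|apply: mem_set; exact: measurable_lt_cst|].
  by move=> y [].
- apply: ge0_integral_le_scale => //.
  + exact: measurable_funM.
  + by move=> y; rewrite mulr_ge0 ?powR_ge0.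
  + exact: ltW.
  have eta_r0 : 0 <= eta `^ p * r `^ (alpha - p * n).
    by rewrite mulr_ge0 ?powR_ge0.
  have := @integral_shells_le _ _ _ mu
    [set y | r / 2 < s y /\ s y < 2 * r] g dist 2 t (p * n) (p * n - alpha)
    (eta `^ p * r `^ (alpha - p * n)).
  rewrite [p * n - alpha - p * n]addrAC subrr add0r; apply => //.
  + exact: le_trans (ltW al0) aln.
  + by apply: powR_opp_lt1; rewrite ?ltr1n.
  + by move=> y _; exact: dyadic_above.
  + move=> k; have k0 : 0 < 2 ^+ k * (2 * t) by rewrite !mulr_gt0 ?exprn_gt0.
    have := good _ k0.
    rewrite [X in (_ <= X)%E -> _](_ : _ = (eta `^ p * r `^ (alpha - p * n) *
      (2 ^+ k * (2 * t)) `^ (p * n - alpha))%:E); last first.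
      congr (_%:E); rewrite -mulrA; congr (_ * _).
      have [lr er] := gt0_expR r0; have [lk ek] := gt0_expR k0.
      by rewrite ek er -expRN -expRD -!expRM -expRD; congr expR; ring.
    apply: ge0_integral_le_subset => //.
    * by apply: measurableI => //; exact: measurable_lt_cst.
    * by apply: measurableI; [exact: measurable_gt_cst|exact: measurable_lt_cst].
    * by move=> y [[? _] ?].
Qed.

End weighted_function.

(** * Covering of the exceptional set *)

(** Federer's form of the Vitali covering argument: Zorn's lemma gives a family
that is maximal among the separated families [D] such that every ball meeting
one of the balls of [D] meets one of at least half its radius.  If a ball met
none of them, one could add to [D] one of those balls whose radius exceeds
half the supremum of their radii.  The separation condition is disjointness of the balls, and since
only centers have to be covered the factor 3 is enough. *)
Lemma vitali_covering (R : realType) (V : normedZmodType R) (E : set V)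
    (rho : V -> R) (M : R) :
  (forall x, E x -> 0 < rho x <= M) ->
  exists D : set V, [/\ D `<=` E,
    (forall x y, D x -> D y -> x != y -> rho x + rho y <= `|x - y|) &
    forall x, E x -> exists2 y, D y & `|x - y| < 3 * rho y].
Proof.
move=> rhoM.
pose meets x y := `|x - y| < rho x + rho y.
pose P (D : set V) := [/\ D `<=` E,
  (forall x y, D x -> D y -> x != y -> rho x + rho y <= `|x - y|) &
  forall x, E x -> (exists2 y, D y & meets x y) ->
    exists2 y, D y & meets x y /\ rho x <= 2 * rho y].
have [|D [[DE Dsep Dhalf] Dmax]] := @Zorn_bigcup _ P.
  move=> F FP Ftot; split.
  - by move=> x [D FD Dx]; have [+ _ _] := FP _ FD; apply.
  - move=> x y [D FD Dx] [D' FD' D'y].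
    have [DD'|D'D] := Ftot _ _ FD FD'.
      by have [_ + _] := FP _ FD'; apply => //; exact: DD'.
    by have [_ + _] := FP _ FD; apply => //; exact: D'D.
  - move=> x Ex [y [D FD Dy] xy]; have [_ _ H] := FP _ FD.
    by have [||z Dz ?] := H x; [by []|exists y|exists z => //; exists D].
exists D; split => // x Ex.
have [xD|xD] := pselect (exists2 y, D y & meets x y).
  have [y Dy [xy xy2]] := Dhalf _ Ex xD; exists y => //.
  by apply: lt_le_trans xy _; lra.
exfalso.
pose S := [set z | E z /\ ~ exists2 y, D y & meets z y].
have Ss : has_sup (rho @` S).
  split; first by exists (rho x), x.
  by exists M => _ [z [Ez _] <-]; case/andP: (rhoM _ Ez).
have [_ [x0 [Ex0 x0D] <-] x0s] : exists2 t, (rho @` S) t & sup (rho @` S) / 2 < t.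
  have s0 : 0 < sup (rho @` S).
    have /andP[x_gt0 _] := rhoM _ Ex.
    by apply: lt_le_trans x_gt0 _; apply: sup_upper_bound => //; exists x.
  have [t St ht] := sup_adherent (divr_gt0 s0 (ltr0n _ 2)) Ss.
  by exists t => //; lra.
have /andP[rx0 _] := rhoM _ Ex0.
have x0x0 : meets x0 x0 by rewrite /meets subrr normr0; lra.
have Dx0 : D `<` D `|` [set x0].
  split; [by move=> ?; left|move=> H; apply: x0D; exists x0 => //].
  by apply: H; right.
apply: Dmax Dx0 _; split.
- by move=> z [/DE//|->].
- move=> y z [Dy|->] [Dz|->] yz; first exact: Dsep.
  + rewrite leNgt; apply/negP => H; apply: x0D; exists y => //.
    by rewrite /meets distrC (addrC (rho x0)).
  + by rewrite leNgt; apply/negP => H; apply: x0D; exists z.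
  + by rewrite eqxx in yz.
- move=> z Ez [y Dy zy].
  have [zD|zD] := pselect (exists2 y, D y & meets z y).
    by have [w Dw ?] := Dhalf _ Ez zD; exists w => //; left.
  exists x0; first by right.
  case: Dy zy => [Dy zy|-> zx0]; first by case: zD; exists y.
  split=> //; have : rho z <= sup (rho @` S).
    by apply: sup_upper_bound => //; exists z.
  lra.
Qed.

Section exceptional_set.
Context d (T : measurableType d) (R : realType) (V : normedZmodType R).
Variables (mu : {measure set T -> \bar R}) (e : T -> V) (g : T -> R).
Hypothesis me : forall x, measurable_fun setT (fun y => `|x - e y|).
Hypotheses (mg : measurable_fun setT g) (g0 : forall y, 0 <= g y).
Hypothesis goo : (\int[mu]_y (g y)%:E < +oo)%E.

(** The cut-off at [`|x| / 2] keeps only points whose total mass for [g] tends to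
0 as [x] goes to infinity, however large [rho] is. *)
Definition near_ball (x : V) (rho : R) : set T :=
  [set y | `|x| / 2 < `|e y| /\ `|x - e y| < rho].

(** A bound by [eta] on a fractional maximal function of [g] at [x]. *)
Definition sparse_at (q eta : R) (x : V) := forall rho, 0 < rho ->
  (\int[mu]_(y in near_ball x rho) (g y)%:E <= (eta * (rho / `|x|) `^ q)%:E)%E.

Let ms : measurable_fun setT (fun y => `|e y|).
Proof. by have := me 0; congr measurable_fun; apply/funext => y; rewrite sub0r normrN. Qed.

Let mball x rho : measurable (near_ball x rho).
Proof.
apply: measurableI; first exact: measurable_gt_cst.
exact: (measurable_lt_cst (me x)).
Qed.

(** Separation makes the sets [near_ball x (rho x)] disjoint, so that their
masses add up to at most the mass of a set containing them all. *)
Lemma sum_integral_separated_le (D X : set V) (rho : V -> R) (A : set T) (a : R) :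
  (forall x y, D x -> D y -> x != y -> rho x + rho y <= `|x - y|) ->
  finite_set X -> X `<=` D -> measurable A ->
  (forall x, D x -> near_ball x (rho x) `<=` A) ->
  (\int[mu]_(y in A) (g y)%:E <= a%:E)%E ->
  (\sum_(x \in X) \int[mu]_(y in near_ball x (rho x)) (g y)%:E <= a%:E)%E.
Proof.
move=> Dsep finX XD mA DA; rewrite fsbig_finite//=.
have mgE D' : measurable_fun D' (EFin \o g).
  by apply/measurable_EFinP; exact: measurable_funTS.
rewrite -(@ge0_integral_bigsetU _ _ _ mu _ (fun x => near_ball x (rho x))
  (EFin \o g)); [|by []|exact: fset_uniq| |exact: mgE|]; last 2 first.
- apply/trivIsetP => x y /=; rewrite !in_fset_set// !inE => Xx Xy xy.
  apply/seteqP; split=> // z [[_ xz] [_ yz]].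
  have := Dsep _ _ (XD _ Xx) (XD _ Xy) xy; rewrite leNgt => /negP; apply.
  rewrite -(subrKA (e z)); apply: le_lt_trans (ler_normD _ _) _.
  by rewrite ltrD// distrC.
- by move=> z _; rewrite lee_fin.
apply: ge0_integral_le_subset => //.
  by apply: bigsetU_measurable => x _.
rewrite -bigcup_fset => z /= [x /= Xx].
by apply: DA; apply: XD; move: Xx; rewrite in_fset_set// inE.
Qed.

(** The balls are selected separately in each shell [R_ k <= `|x| < R_ k.+1]
among those witnessing that [sparse_at q (eta_ k)] fails, with [eta_ k] tending
to 0.  Each of them carries a mass of [g] larger than
[eta_ k * (r / `|x|) `^ q], and the masses in the [k]-th shell add up to at most
[tau k], so the sums over the shells form a convergent geometric series. *)
Lemma exceptional_balls (E : set V) (q : R) : 0 <= q ->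
  exists (J : set nat) (c : nat -> V) (rho : nat -> R),
    [/\ forall j, J j -> E (c j) /\ 0 < rho j,
        (\esum_(j in J) ((rho j / `|c j|) `^ q)%:E < +oo)%E &
        forall eta, 0 < eta -> exists2 r0, 0 < r0 & forall x, E x ->
          (forall j, J j -> rho j <= `|x - c j|) -> r0 <= `|x| ->
          sparse_at q eta x].
Proof.
move=> q0.
pose eta_ k : R := k.+1%:R^-1.
have eta_0 k : 0 < eta_ k by rewrite invr_gt0.
pose tau k := eta_ k * 2^-1 ^+ k.
have tau0 k : 0 < tau k by rewrite mulr_gt0 ?exprn_gt0.
have /choice[R_ R_P] : forall k, exists r : R, [/\ k%:R <= r, 1 <= r &
    (\int[mu]_(y in [set y | (r / 2 < `|e y|)%R]) (g y)%:E <= (tau k)%:E)%E].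
  move=> k; have [H HP] := integral_tail_le mg ms g0 goo (tau0 k).
  exists (Num.max (k%:R + 1) (2 * H)); split.
  - by rewrite le_max lerDl ler01.
  - by rewrite le_max lerDr ler0n.
  - by apply: HP; rewrite ler_pdivlMr// mulrC le_max lexx orbT.
pose bad k x := [/\ E x, R_ k <= `|x| < R_ k.+1 & ~ sparse_at q (eta_ k) x].
have /choice[r_ r_P] : forall kx : nat * V, exists r : R, bad kx.1 kx.2 ->
    [/\ 0 < r, r <= R_ kx.1.+1 & (((eta_ kx.1 * (r / `|kx.2|) `^ q)%:E <
      \int[mu]_(y in near_ball kx.2 r) (g y)%:E)%E)].
  move=> [k x] /=; have [|nb] := pselect (bad k x); last by exists 0.
  move=> [Ex /andP[Rx xR] /existsNP[r /not_implyP[r0 /negP]]].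
  rewrite -ltNge => rP; exists r => _; split => //.
  (* A radius [r > R_ k.+1] exceeds [`|x|], so that [(r / `|x|) `^ q >= 1],
     whereas all the mass beyond [R_ k / 2] is at most [eta_ k]. *)
  rewrite leNgt; apply/negP => Rr; move: rP; rewrite ltNge => /negP; apply.
  have [_ R1 RP] := R_P k.
  have x0 : 0 < `|x| by apply: lt_le_trans Rx; exact: lt_le_trans R1.
  apply: (@le_trans _ _ (tau k)%:E).
    apply: ge0_integral_le_subset RP => //; first exact: measurable_gt_cst.
    by move=> y [+ _] /=; apply: le_lt_trans; rewrite ler_pM2r.
  rewrite lee_fin ler_wpM2l ?(ltW (eta_0 _))//.
  apply: (@le_trans _ _ 1); first by rewrite exprn_ile1// ltW// half_lt1.
  have : 1 `^ q <= (r / `|x|) `^ q.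
    apply: ge0_ler_powR; rewrite ?nnegrE ?divr_ge0 ?(ltW r0)//.
    by rewrite ler_pdivlMr// mul1r (ltW (lt_trans xR Rr)).
  by rewrite powR1.
have /choice[D DP] : forall k, exists D : set V, [/\ D `<=` bad k,
    (forall x y, D x -> D y -> x != y -> r_ (k, x) + r_ (k, y) <= `|x - y|) &
    forall x, bad k x -> exists2 y, D y & `|x - y| < 3 * r_ (k, y)].
  move=> k; apply: (@vitali_covering _ _ _ _ (R_ k.+1)) => x bx.
  by have [-> ->] := r_P (k, x) bx.
pose a (kx : nat * V) := (3 * r_ kx / `|kx.2|) `^ q.
pose S := setT `*`` D.
have Sbad kx : S kx -> bad kx.1 kx.2 by move=> [_]; have [+ _ _] := DP kx.1; apply.
have Sx kx : S kx -> 0 < `|kx.2|.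
  move=> /Sbad[_ /andP[Rx _] _]; apply: lt_le_trans Rx.
  by have [_ /(lt_le_trans ltr01)] := R_P kx.1.
have Sr kx : S kx -> 0 < r_ kx.
  by case: kx => k x /Sbad /(r_P (k, x))[].
have sumD k : (\esum_(x in D k) (a (k, x))%:E <=
    (3 `^ q * 2^-1 ^+ k)%:E)%E.
  have [Dbad Dsep _] := DP k; have [_ _ RP] := R_P k.
  apply: ge_ereal_sup => _ /= [X [finX XD] <-].
  have H : (\sum_(x \in X) \int[mu]_(y in near_ball x (r_ (k, x))) (g y)%:E <=
      (tau k)%:E)%E.
    apply: (sum_integral_separated_le Dsep) RP => //.
      exact: measurable_gt_cst.
    move=> x /Dbad[_ /andP[Rx _] _] y [+ _] /=.
    by apply: le_lt_trans; rewrite ler_pM2r.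
  have -> : 3 `^ q * 2^-1 ^+ k = 3 `^ q / eta_ k * tau k.
    by rewrite /tau; field; rewrite gt_eqF.
  rewrite EFinM; apply: le_trans (lee_wpmul2l _ H); last first.
    by rewrite lee_fin divr_ge0 ?powR_ge0// ltW.
  rewrite ge0_mule_fsumr; last first.
    by move=> x; apply: integral_ge0 => y _; rewrite lee_fin.
  apply: lee_fsum => // x /XD Dx.
  have Sk : S (k, x) by split.
  have [_ _ /ltW /=] := r_P (k, x) (Dbad _ Dx).
  move=> /(lee_wpmul2l (x := (3 `^ q / eta_ k)%:E)); rewrite lee_fin => H'.
  apply: le_trans (H' _); last by rewrite divr_ge0 ?powR_ge0// ltW.
  rewrite -EFinM lee_fin /a /= -mulrA powRM ?divr_ge0 ?(ltW (Sx _ Sk)) ?(ltW (Sr _ Sk))//.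
  by rewrite le_eqVlt; apply/orP; left; apply/eqP; field; rewrite gt_eqF.
have sumS : (\esum_(kx in S) (a kx)%:E < +oo)%E.
  have -> : (\esum_(kx in S) (a kx)%:E = \esum_(kx in S) (a (kx.1, kx.2))%:E)%E.
    by apply: eq_esum => -[].
  rewrite -(@esum_esum _ _ _ setT D (fun k x => (a (k, x))%:E)); last first.
    by move=> k x _ _; rewrite lee_fin powR_ge0.
  apply: (@le_lt_trans _ _ (\esum_(k in setT) (3 `^ q * 2^-1 ^+ k)%:E)%E).
    by apply: le_esum => k _; exact: sumD.
  rewrite -nneseries_esumT; last first.
    by move=> k; rewrite lee_fin mulr_ge0 ?exprn_ge0 ?powR_ge0.
  apply: le_lt_trans (nneseries_geometric_le _ _) (ltry _).
    exact: powR_ge0.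
  by rewrite half_lt1 invr_ge0 ler0n.
have : countable S.
  apply: esum_lty_countable sumS => kx Skx.
  by rewrite powR_gt0// divr_gt0 ?mulr_gt0 ?Sx ?Sr.
move=> /countable_injP[f finj].
(* The function [i] inverts on [f @` S] the injection [f] of the index set [S]
   into the natural numbers. *)
have /choice[i iP] : forall j, exists kx, (f @` S) j -> S kx /\ f kx = j.
  move=> j; have [[kx Skx <-]|nj] := pselect ((f @` S) j); last by exists (0%N, 0).
  by exists kx.
exists (f @` S), (fun j => (i j).2), (fun j => 3 * r_ (i j)); split.
- move=> j /iP[Si _]; split; first by have [] := Sbad _ Si.
  by rewrite mulr_gt0 ?Sr.
- have -> : (\esum_(j in f @` S) ((3 * r_ (i j) / `|(i j).2|) `^ q)%:E =
      \esum_(kx in S) (a kx)%:E)%E.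
    apply/esym; apply: reindex_esum; split.
    + by move=> j /iP[].
    + move=> j j'; rewrite !inE => /iP[_ ij] /iP[_ ij'] ii.
      by rewrite -ij -ij' ii.
    + move=> kx Skx; exists (f kx); first by exists kx.
      have [Si fi] : S (i (f kx)) /\ f (i (f kx)) = f kx by apply: iP; exists kx.
      by apply: finj => //; rewrite inE.
  exact: sumS.
- move=> eta eta0.
  pose K := Num.truncn eta^-1.
  have R0 : 0 < R_ K by have [_ /(lt_le_trans ltr01)] := R_P K.
  exists (R_ K) => // x Ex xJ RKx.
  have exk : exists k, R_ k <= `|x| by exists K.
  have ubk k : R_ k <= `|x| -> (k <= (Num.truncn `|x|).+1)%N.
    move=> Rkx; rewrite -(ler_nat R); apply: le_trans (ltW (truncnS_gt _)).
    by apply: le_trans Rkx; have [] := R_P k.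
  (* As [R_] may fail to be monotone, the shell of [x] is that of the largest
     [k] with [R_ k <= `|x|]. *)
  case: (ex_maxnP exk ubk) => k Rkx kmax.
  have Kk : (K <= k)%N by exact: kmax.
  have xRk : `|x| < R_ k.+1.
    by rewrite ltNge; apply/negP => /kmax; rewrite ltnn.
  have thk : sparse_at q (eta_ k) x.
    apply: contrapT => nth; have [Dbad _ Dcov] := DP k.
    have [|y Dy xy] := Dcov x; first by split=> //; rewrite Rkx.
    have Sky : S (k, y) by split.
    have iky : i (f (k, y)) = (k, y).
      have [Si fi] : S (i (f (k, y))) /\ f (i (f (k, y))) = f (k, y).
        by apply: iP; exists (k, y).
      by apply: finj; rewrite ?inE.
    have := xJ (f (k, y)); rewrite iky /= leNgt xy => /(_ _)/negP; apply => //.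
    by exists (k, y).
  move=> rho rho0; apply: le_trans (thk _ rho0) _.
  rewrite lee_fin ler_wpM2r ?powR_ge0// -[leRHS]invrK lef_pV2 ?posrE ?invr_gt0//.
  by rewrite (le_trans (ltW (truncnS_gt _)))// ler_nat.
Qed.

End exceptional_set.

Section potential.
Context d (T : measurableType d) (R : realType) (V : normedZmodType R).
Variables (mu : {measure set T -> \bar R}) (e : T -> V) (F : T -> R).
Variables (N p gamma beta delta n alpha : R).
Hypothesis me : forall x, measurable_fun setT (fun y => `|x - e y|).
Hypotheses (mF : measurable_fun setT F) (F0 : forall y, 0 <= F y).
Hypothesis vol : forall rho, 0 < rho ->
  (mu [set y | (`|e y| < rho)%R] <= ((2 * rho) `^ N)%:E)%E.
Hypotheses (N0 : 0 < N) (p1 : 1 <= p) (n0 : 0 <= n).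
Hypotheses (betaE : p * beta = gamma + N * (p - 1)) (beta0 : 0 < beta).
Hypotheses (delta0 : 0 < delta) (betan : p * (beta - n) + delta * (p - 1) <= 0).
Hypothesis alphan : 0 < alpha <= p * n.

Local Notation g := (fun y => F y `^ p * (1 + `|e y|) `^ (- gamma)).

Hypothesis goo : (\int[mu]_y (g y)%:E < +oo)%E.

Let ms : measurable_fun setT (fun y => `|e y|).
Proof. by have := me 0; congr measurable_fun; apply/funext => y; rewrite sub0r normrN. Qed.

Let mg : measurable_fun setT g.
Proof.
apply: measurable_funM; first exact: measurable_fun_powR.
apply: (@measurable_fun_powR _ _ _ (fun y => 1 + `|e y|)).
exact: measurable_funD.
Qed.

Let g0 y : 0 <= g y. Proof. by rewrite mulr_ge0 ?powR_ge0. Qed.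

(** Each of the three regions contributes a third of [eps].  The first two are
of order [`|x| `^ (beta - n)], which is at most the stated bound because
[t <= `|x|]. *)
Lemma potential_le_at_sparse (eps : R) : 0 < eps ->
  exists2 eta, 0 < eta & exists2 r0, 0 < r0 & forall (x : V) (t : R),
    0 < t -> t <= `|x| -> (forall y, t <= `|x - e y|) -> r0 <= `|x| ->
    sparse_at mu e g (p * n - alpha) eta x ->
    (\int[mu]_y (F y * `|x - e y| `^ (- n))%:E <=
     (eps * (t `^ (- (alpha / p)) * `|x| `^ (beta - n + alpha / p)))%:E)%E.
Proof.
move=> eps0; have [al0 _] := andP alphan; have p0 : 0 < p by exact: lt_le_trans p1.
pose C := 4 `^ N + 3 `^ `|gamma| * (2 `^ (p * n - alpha) / (1 - 2 `^ (- alpha))).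
have C0 : 0 < C.
  rewrite ltr_pwDl ?powR_gt0// mulr_ge0 ?powR_ge0// divr_ge0 ?powR_ge0//.
  by rewrite subr_ge0 ltW//; apply: powR_opp_lt1; rewrite ?ltr1n.
have [eta eta0 etaE] : exists2 eta, 0 < eta & C * eta = eps / 3.
  exists (eps / (3 * C)); first by apply: divr_gt0 => //; exact: mulr_gt0.
  by field; rewrite gt_eqF.
have s0 y : 0 <= `|e y| by [].
have e2n : 0 < eps / 3 / 2 `^ n by rewrite !divr_gt0 ?powR_gt0.
have e4n : 0 < eps / 3 / 4 `^ n by rewrite !divr_gt0 ?powR_gt0.
have [r1 r11 inner] :=
  integral_inner_le N0 p1 betaE ms s0 mF F0 vol goo beta0 e2n.
have [r2 r21 outer] :=
  integral_outer_le N0 p1 betaE ms s0 mF F0 vol goo delta0 betan e4n.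
exists (eta `^ p); first exact: powR_gt0.
exists (Num.max r1 r2); first by rewrite lt_max (lt_le_trans ltr01 r11).
move=> x t t0 tx tdist; rewrite ge_max => /andP[r1x r2x] thin.
have x1 : 1 <= `|x| by exact: le_trans r1x.
have x0 : 0 < `|x| by exact: lt_le_trans x1.
have d0 y : 0 < `|x - e y| by exact: lt_le_trans (tdist y).
set Theta := _ * `|x| `^ _.
have Th0 : 0 < Theta by rewrite mulr_gt0 ?powR_gt0.
have xTh : `|x| `^ (beta - n) <= Theta.
  rewrite /Theta [X in _ <= _ * X]powRD; last by rewrite implybE (gt_eqF x0) orbT.
  rewrite mulrCA ler_peMr ?powR_ge0// powRN mulrC ler_pdivlMr ?powR_gt0// mul1r.
  by apply: ge0_ler_powR; rewrite ?nnegrE// ?divr_ge0// ltW.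
have mk : measurable_fun setT (fun y => F y * `|x - e y| `^ (- n)).
  by apply: measurable_funM => //; exact: measurable_fun_powR.
have k0 y : 0 <= F y * `|x - e y| `^ (- n) by rewrite mulr_ge0 ?powR_ge0.
have m1 : measurable [set y | `|e y| <= `|x| / 2] by exact: measurable_le_cst.
have m2 : measurable [set y | `|e y| < 2 * `|x|] by exact: measurable_lt_cst.
have mh : measurable_fun setT (fun y => 1 + `|e y|) by exact: measurable_funD.
have powN_le a b : 0 < a -> a <= b -> b `^ (- n) <= a `^ (- n).
  move=> a0 ab; rewrite !powRN lef_pV2 ?posrE ?powR_gt0//; last first.
    exact: lt_le_trans ab.
  by apply: ge0_ler_powR; rewrite ?nnegrE// ltW// (lt_le_trans a0).
have -> : eps * Theta = eps / 3 * Theta + (eps / 3 * Theta + eps / 3 * Theta).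
  by field.
apply: (@ge0_integral_le_split _ _ _ _ _ [set y | `|e y| <= `|x| / 2]) => //;
  last apply: (@ge0_integral_le_split _ _ _ _ _ [set y | `|e y| < 2 * `|x|]) => //.
- rewrite setTI.
  apply: (@le_trans _ _ ((`|x| / 2) `^ (- n) *
      (eps / 3 / 2 `^ n * `|x| `^ beta))%:E); last first.
    rewrite lee_fin; apply: (@le_trans _ _ (eps / 3 * `|x| `^ (beta - n))).
      rewrite powRM ?invr_ge0// powRD ?(gt_eqF x0) ?implybT//.
      rewrite [_^-1 `^ _]powRN -powR_inv1// powRAC powR_inv1 ?powR_ge0// invrK.
      by rewrite le_eqVlt; apply/orP; left; apply/eqP; field; rewrite gt_eqF ?powR_gt0.
    by rewrite ler_wpM2l// divr_ge0// ltW.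
  apply: (@ge0_integral_le_ptwise _ _ _ _ _ _
    (fun y => (`|x| / 2) `^ (- n) * F y)) => //.
  + exact: measurable_funM.
  + move=> y /= yx; rewrite mulrC ler_wpM2r//; apply: powN_le.
      by rewrite divr_gt0.
    have : `|x| <= `|x - e y| + `|e y| by rewrite -{1}(subrK (e y) x) ler_normD.
    lra.
  + apply: ge0_integral_le_scale; rewrite ?powR_ge0//.
    apply: ge0_integral_le_subset (inner _ r1x) => //.
      exact: (measurable_lt_cst mh).
    by move=> y /=; lra.
- exact: measurableD.
- apply: (@le_trans _ _ (C * (eta * Theta))%:E); last first.
    by rewrite mulrA etaE.
  apply: (@ge0_integral_le_subset _ _ _ _ _
    [set y | `|x| / 2 < `|e y| /\ `|e y| < 2 * `|x|]) => //.
  + by apply: measurableI => //; exact: measurableD.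
  + by apply: measurableI => //; exact: measurable_gt_cst.
  + by move=> y [[_ /negP]]; rewrite -ltNge.
  + apply: (integral_near_le p1 betaE ms s0 mF F0 vol alphan x1 t0 eta0 (me x)).
    * exact: tdist.
    * exact: thin.
- apply: (@le_trans _ _ (4^-1 `^ (- n) *
      (eps / 3 / 4 `^ n * `|x| `^ (beta - n)))%:E); last first.
    rewrite lee_fin; apply: (@le_trans _ _ (eps / 3 * `|x| `^ (beta - n))).
      rewrite [_^-1 `^ _]powRN -powR_inv1// powRAC powR_inv1 ?powR_ge0// invrK.
      by rewrite le_eqVlt; apply/orP; left; apply/eqP; field; rewrite gt_eqF ?powR_gt0.
    by rewrite ler_wpM2l// divr_ge0// ltW.
  apply: (@ge0_integral_le_ptwise _ _ _ _ _ _
    (fun y => 4^-1 `^ (- n) * (F y * (1 + `|e y|) `^ (- n)))) => //.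
  + by apply: measurableD => //; exact: measurableD.
  + apply: measurable_funM => //; apply: measurable_funM => //.
    exact: (measurable_fun_powR mh).
  + move=> y [_ /= /negP]; rewrite -leNgt => yx.
    rewrite mulrCA ler_wpM2l// -powRM ?invr_ge0 ?addr_ge0//; apply: powN_le.
      by rewrite mulr_gt0 ?invr_gt0// ltr_wpDr.
    have : `|e y| <= `|x - e y| + `|x|.
      by rewrite distrC -{1}(subrK x (e y)) ler_normD.
    lra.
  + apply: ge0_integral_le_scale; rewrite ?powR_ge0//.
    * by apply: measurableD => //; exact: measurableD.
    * by apply: measurable_funM => //; exact: (measurable_fun_powR mh).
    * by move=> y; rewrite mulr_ge0 ?powR_ge0.
    apply: ge0_integral_le_subset (outer _ r2x) => //.
    * by apply: measurableD => //; exact: measurableD.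
    * exact: (measurable_ge_cst mh).
    * by apply: measurable_funM => //; exact: (measurable_fun_powR mh).
    * by move=> y; rewrite mulr_ge0 ?powR_ge0.
    * by move=> y [_ /= /negP]; rewrite -leNgt; lra.
Qed.

Lemma potential_little_o (E : set V) (t : V -> R) :
  (forall x, E x -> [/\ 0 < t x, t x <= `|x| & forall y, t x <= `|x - e y|]) ->
  exists (J : set nat) (c : nat -> V) (rho : nat -> R),
    [/\ forall j, J j -> E (c j) /\ 0 < rho j,
        (\esum_(j in J) ((rho j / `|c j|) `^ (p * n - alpha))%:E < +oo)%E &
        forall eps, 0 < eps -> exists2 r0, 0 < r0 & forall x, E x ->
          (forall j, J j -> rho j <= `|x - c j|) -> r0 <= `|x| ->
          (\int[mu]_y (F y * `|x - e y| `^ (- n))%:E <=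
            (eps * (t x `^ (- (alpha / p)) *
                    `|x| `^ (beta - n + alpha / p)))%:E)%E].
Proof.
move=> Et; have q0 : 0 <= p * n - alpha by rewrite subr_ge0; case/andP: alphan.
have [J [c [rho [cE sumJ Jthin]]]] := exceptional_balls me mg g0 goo E q0.
exists J, c, rho; split => // eps /potential_le_at_sparse[eta eta0 [r1 r10 H]].
have [r2 r20 thin] := Jthin _ eta0.
exists (Num.max r1 r2); first by rewrite lt_max r10.
move=> x Ex xJ; rewrite ge_max => /andP[r1x r2x].
by have [t0 tx tdist] := Et _ Ex; apply: H => //; exact: thin.
Qed.

End potential.

(** * Row vectors and Lebesgue measure *)

Section borel_to_lebesgue.
Context (R : realType) (m : nat).

Lemma lebesgue_measurable (A : set 'rV[R]_m) : measurable A ->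
  measurable (A : set (lebesgueType R m)).
Proof. by move=> mA; apply: sub_caratheodory; apply: sub_sigma_algebra. Qed.

Lemma lebesgue_rVE (A : set 'rV[R]_m) : measurable A ->
  @lebesgue_rV R m A = borel_lebesgue R m A.
Proof. exact: measurable_mu_extE. Qed.

Lemma measurable_fun_lebesgue (f : 'rV[R]_m -> R) :
  measurable_fun [set: 'rV[R]_m] f ->
  measurable_fun [set: lebesgueType R m] f.
Proof.
move=> mf _ B mB; apply: lebesgue_measurable.
by have := mf measurableT B mB.
Qed.

End borel_to_lebesgue.

Section row_norms.
Context (R : realType).

Lemma measurable_fun_bigmaxr d (T : measurableType d) (I : Type) (s : seq I)
    (f : I -> T -> R) : (forall i, measurable_fun setT (f i)) ->
  measurable_fun setT (fun t => \big[Num.max/0]_(i <- s) f i t).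
Proof.
move=> mf; elim: s => [|i s IH].
  by under eq_fun do rewrite big_nil; exact: measurable_cst.
by under eq_fun do rewrite big_cons; exact: measurable_maxr.
Qed.

Lemma measurable_fun_row_norm d (T : measurableType d) m (Y : T -> 'rV[R]_m) :
  (forall i, measurable_fun setT (fun t => Y t ord0 i)) ->
  measurable_fun setT (fun t => `|Y t|).
Proof.
move=> mY; rewrite (_ : (fun t => _) =
    (fun t => \big[Num.max/0]_ij `|Y t ij.1 ij.2|)); last first.
  by apply/funext => t; rewrite /Num.norm /= mx_normrE.
apply: measurable_fun_bigmaxr => -[i j] /=; rewrite (ord1 i).
exact: measurableT_comp.
Qed.

Lemma measurable_fun_enorm d (T : measurableType d) m (Y : T -> 'rV[R]_m) :
  (forall i, measurable_fun setT (fun t => Y t ord0 i)) ->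
  measurable_fun setT (fun t => enorm (Y t)).
Proof.
move=> mY; rewrite (_ : (fun t => _) =
    (fun t => (\sum_(i < m) Y t ord0 i ^+ 2) `^ 2^-1)); last first.
  by apply/funext => t; rewrite powR12_sqrt// sumr_ge0// => i _; exact: sqr_ge0.
apply: (@measurable_fun_powR _ _ _ (fun t => \sum_(i < m) Y t ord0 i ^+ 2)).
by apply: measurable_sum => i; exact: measurable_funX.
Qed.

Lemma coord_le_row_norm m (x : 'rV[R]_m) i : `|x ord0 i| <= `|x|.
Proof.
rewrite [leRHS]/Num.norm /= mx_normrE; apply: le_trans (le_bigmax _ _ (ord0, i)).
by [].
Qed.

Lemma row_norm_lt m (x : 'rV[R]_m) (r : R) : 0 < r ->
  (`|x| < r) <-> (forall i, `|x ord0 i| < r).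
Proof.
move=> r0; split=> [xr i|H]; first exact: le_lt_trans (coord_le_row_norm _ _) xr.
rewrite /Num.norm /= mx_normrE; apply/bigmax_ltP; split=> // -[i j] _ /=.
by rewrite ord1.
Qed.

Lemma enorm_ge0 m (x : 'rV[R]_m) : 0 <= enorm x.
Proof. exact: sqrtr_ge0. Qed.

Lemma row_norm_le_enorm m (x : 'rV[R]_m) : `|x| <= enorm x.
Proof.
rewrite [leLHS]/Num.norm /= mx_normrE; apply/bigmax_leP.
split=> [|[i j] _ /=]; first exact: enorm_ge0.
rewrite (ord1 i) -sqrtr_sqr ler_wsqrtr// (bigD1 j)//= lerDl.
by rewrite sumr_ge0// => k _; exact: sqr_ge0.
Qed.

Lemma enorm_le_row_norm m (x : 'rV[R]_m) : enorm x <= m%:R * `|x|.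
Proof.
rewrite -[leRHS]ger0_norm ?mulr_ge0// -sqrtr_sqr ler_wsqrtr//.
apply: (@le_trans _ _ (\sum_(i < m) `|x| ^+ 2)).
  apply: ler_sum => i _; rewrite -real_normK ?num_real//.
  by rewrite ler_sqr ?nnegrE// coord_le_row_norm.
rewrite sumr_const card_ord -[leLHS]mulr_natl exprMn ler_wpM2r ?sqr_ge0//.
by rewrite -natrX ler_nat; case: m x => // k _; rewrite expnS leq_pmulr// expn_gt0.
Qed.

End row_norms.

Section volume.
Context (R : realType).

Definition cube m (rho : R) : set 'rV[R]_m :=
  [set y | forall i, `|y ord0 i| < rho].
Arguments cube : clear implicits.

Lemma measurable_cube m (rho : R) : measurable (cube m rho).
Proof.
rewrite (_ : cube m rho = \bigcap_(i in [set: 'I_m])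
    [set y | `|coord_rV i y| < rho]); last first.
  by apply/seteqP; split => y H i => [_|]; exact: H.
apply: fin_bigcap_measurable => [|i _]; first exact: finite_finset.
apply: measurable_lt_cst.
by apply: measurableT_comp => //; exact: measurable_coord_rV.
Qed.

Lemma borel_lebesgue_cube m (rho : R) : 0 < rho ->
  (borel_lebesgue R m (cube m rho) <= ((2 * rho) ^+ m)%:E)%E.
Proof.
move=> rho0; elim: m => [|m IH].
  by rewrite expr0 /= diracE lee_fin; case: (_ \in _).
have -> : borel_lebesgue R m.+1 (cube m.+1 rho) =
  (lebesgue_measure \x borel_lebesgue R m)%E (@cons_rV R m @^-1` cube m.+1 rho).
  by [].
have -> : @cons_rV R m @^-1` cube m.+1 rho = `](- rho), rho[%classic `*` cube m rho.
  apply/seteqP; split => -[t y] /=.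
    move=> H; split => [|i].
      have := H (lshift m (ord0 : 'I_1)).
      rewrite /cons_rV (row_mxEl (t%:M : 'M[R]_1)) mxE eqxx mulr1n.
      by rewrite in_itv /= ltr_norml.
    by have := H (rshift 1 i); rewrite /cons_rV (row_mxEr (t%:M : 'M[R]_1)).
  move=> [ty yH] i; have [j ->|j ->] := split_ordP (i : 'I_(1 + m)).
    rewrite /cons_rV (row_mxEl (t%:M : 'M[R]_1)) mxE !ord1 eqxx mulr1n /=.
    by move: ty; rewrite in_itv /= ltr_norml.
  by rewrite /cons_rV (row_mxEr (t%:M : 'M[R]_1)); exact: yH.
rewrite product_measure1E//; last exact: measurable_cube.
have leb : lebesgue_measure (`](- rho), rho[%classic : set R) = (2 * rho)%:E.
  rewrite lebesgue_measure_itv /= lte_fin gtrN// -EFinB opprK.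
  by rewrite mulr_natl mulr2n.
rewrite [X in (X * _ <= _)%E](_ : _ = (2 * rho)%:E); last exact: leb.
rewrite exprS [X in (_ <= X)%E]EFinM; apply: lee_wpmul2l => //.
by rewrite lee_fin mulr_ge0// ltW.
Qed.

Lemma lebesgue_rV_sup_ball m (rho : R) : 0 < rho ->
  (@lebesgue_rV R m [set y : 'rV[R]_m | (`|y| < rho)%R] <=
   ((2 * rho) `^ m%:R)%:E)%E.
Proof.
move=> rho0; have -> : [set y : 'rV[R]_m | `|y| < rho] = cube m rho.
  by apply/seteqP; split => y /= /(row_norm_lt _ rho0).
rewrite powR_mulrn ?mulr_ge0 ?(ltW rho0)//.
apply: le_trans (borel_lebesgue_cube m rho0).
by rewrite lebesgue_rVE//; exact: measurable_cube.
Qed.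

End volume.

(** * The Poisson kernel of the half space *)

Section half_space_lemmas.
Context (R : realType) (n : nat).
Implicit Types (x : 'rV[R]_(n.-1 + 1)) (y : 'rV[R]_n.-1).

Definition boundary_point y : 'rV[R]_(n.-1 + 1) := row_mx y 0.

Lemma row_norm_boundary_point y : `|boundary_point y| = `|y|.
Proof.
have le_r (r : R) : 0 < r -> `|boundary_point y| < r <-> `|y| < r.
  move=> r0; split=> /(row_norm_lt _ r0) H; apply/(row_norm_lt _ r0) => i.
    by have := H (lshift 1 i); rewrite row_mxEl.
  have [j ->|j ->] := split_ordP i; first by rewrite row_mxEl.
  by rewrite row_mxEr mxE normr0.
apply/eqP; rewrite eq_le; apply/andP; split; apply/ler_addgt0Pr => e e0.
  by apply/ltW/le_r; rewrite ?ltrDl// ltr_wpDl.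
by apply/ltW/le_r; rewrite ?ltrDl// ltr_wpDl.
Qed.

Lemma height_le_row_norm x : height x <= `|x|.
Proof.
rewrite /height mxE; apply: le_trans (ler_norm _) _.
exact: coord_le_row_norm.
Qed.

Lemma height_boundary_sub x y : height (x - boundary_point y) = height x.
Proof. by rewrite /height !mxE (unsplitK (inr _)) /= mxE subr0. Qed.

Lemma measurable_coord_boundary_sub d (T : measurableType d)
    (Y : T -> 'rV[R]_n.-1) x i :
  (forall j, measurable_fun setT (fun t => Y t ord0 j)) ->
  measurable_fun setT (fun t => (x - boundary_point (Y t)) ord0 i).
Proof.
move=> mY; have [j ->|j ->] := split_ordP i; last first.
  under eq_fun do rewrite !mxE (unsplitK (inr _)) /= mxE.
  exact: measurable_cst.
under eq_fun do rewrite !mxE (unsplitK (inl _)) /=.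
exact: measurable_funB.
Qed.

Lemma sphere_area_ge0 k : 0 <= sphere_area k :> R.
Proof.
rewrite /sphere_area divr_ge0 ?mulr_ge0 ?powR_ge0//.
by apply: Rintegral_ge0 => s _; rewrite mulr_ge0 ?powR_ge0 ?expR_ge0.
Qed.

Lemma poisson_kernelE x y : poisson_kernel x y =
  2 * height x / sphere_area n * enorm (x - boundary_point y) `^ (- n%:R).
Proof. by rewrite /poisson_kernel powRN powR_mulrn ?enorm_ge0// invfM mulrA. Qed.

Lemma measurable_poisson_kernel d (T : measurableType d)
    (Y : T -> 'rV[R]_n.-1) x :
  (forall j, measurable_fun setT (fun t => Y t ord0 j)) ->
  measurable_fun setT (fun t => poisson_kernel x (Y t)).
Proof.
move=> mY.
have md : measurable_fun setT (fun t => enorm (x - boundary_point (Y t))).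
  by apply: measurable_fun_enorm => i; exact: measurable_coord_boundary_sub.
rewrite (funext (fun t => poisson_kernelE x (Y t))).
apply: measurable_funM; first exact: measurable_cst.
exact: (measurable_fun_powR md).
Qed.

Lemma poisson_kernel_le x y : 0 < height x ->
  `|poisson_kernel x y| <=
    2 * height x / sphere_area n * `|x - boundary_point y| `^ (- n%:R).
Proof.
move=> x0; have K0 : 0 <= 2 * height x / sphere_area n.
  by apply: divr_ge0; [rewrite mulr_ge0// ltW|exact: sphere_area_ge0].
rewrite poisson_kernelE ger0_norm; last exact: (mulr_ge0 K0 (powR_ge0 _ _)).
rewrite ler_wpM2l//.
have d0 : 0 < `|x - boundary_point y|.
  by apply: lt_le_trans (height_le_row_norm _); rewrite height_boundary_sub.
have de := row_norm_le_enorm (x - boundary_point y).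
rewrite !powRN lef_pV2 ?posrE ?powR_gt0//; last exact: lt_le_trans de.
by apply: ge0_ler_powR; rewrite ?nnegrE ?enorm_ge0.
Qed.

End half_space_lemmas.

(** The measure space is kept abstract, with a map [Y] to the boundary: the
argument uses Lebesgue measure only through the measure of balls. *)
Lemma poisson_integral_little_o (R : realType) (n : nat) (p gamma alpha : R)
    d (T : measurableType d) (mu : {measure set T -> \bar R})
    (Y : T -> 'rV[R]_n.-1) (f : T -> R) :
  (3 <= n)%N -> 1 <= p ->
  (1 < p -> - ((n%:R - 1) * (p - 1)) < gamma < (n%:R - 1) + p) ->
  (p = 1 -> 0 < gamma <= n%:R) ->
  0 < alpha <= n%:R ->
  (forall j, measurable_fun setT (fun t => Y t ord0 j)) ->
  (forall rho, 0 < rho ->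
    (mu [set t | (`|Y t| < rho)%R] <= ((2 * rho) `^ n.-1%:R)%:E)%E) ->
  measurable_fun setT f ->
  (\int[mu]_t (`|f t| `^ p / (1 + enorm (Y t)) `^ gamma)%:E < +oo)%E ->
  exists (J : set nat) (c : nat -> 'rV[R]_(n.-1 + 1)) (rho : nat -> R),
    [/\ forall j, J j -> upper_half_space (c j) /\ 0 < rho j,
        (\esum_(j in J)
           (rho j `^ (p * n%:R - alpha) /
            enorm (c j) `^ (p * n%:R - alpha))%:E < +oo)%E &
        little_o_at_infinity
          (@upper_half_space R n `\` \bigcup_(j in J) eball (c j) (rho j))
          (fun x => \int[mu]_t (poisson_kernel x (Y t) * f t))
          (fun x => height x `^ (1 - alpha / p) *
             enorm x `^ (gamma / p + (n%:R - 1) * (1 - p^-1)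
                         - n%:R + alpha / p))].
Proof.
move=> n_ge3 p_ge1 gamma_p_gt1 gamma_p_eq1 alpha_bounds mY vol0 f_meas f_int.
have p0 : 0 < p by exact: lt_le_trans p_ge1.
have pN0 : p != 0 by rewrite gt_eqF.
pose m : R := n%:R - 1.
have mE : n.-1%:R = m by rewrite /m -subn1 natrB// (leq_trans _ n_ge3).
have m0 : 0 < m by rewrite -mE ltr0n -subn1 subn_gt0 (leq_trans _ n_ge3).
have nE : n%:R = m + 1 by rewrite subrK.
pose beta := gamma / p + m * (1 - p^-1).
have betaE : p * beta = gamma + m * (p - 1) by rewrite /beta; field.
have beta0 : 0 < beta.
  rewrite -(pmulr_rgt0 _ p0) betaE; have [p1|p1] := ltP 1 p.
    by have /andP[+ _] := gamma_p_gt1 p1; rewrite -/m; lra.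
  have p1E : p = 1 by apply/eqP; rewrite eq_le p1.
  by have /andP[+ _] := gamma_p_eq1 p1E; rewrite p1E subrr mulr0 addr0.
(* When [p = 1] the term in [delta] vanishes, which is why [gamma = n] is
   allowed in that case only. *)
have [delta delta0 betan] : exists2 delta, 0 < delta &
    p * (beta - n%:R) + delta * (p - 1) <= 0.
  have [p1|p1] := ltP 1 p.
    have bn : beta < n%:R.
      rewrite -(ltr_pM2l p0) betaE nE.
      by have /andP[_] := gamma_p_gt1 p1; rewrite -/m; lra.
    exists (n%:R - beta); first by rewrite subr_gt0.
    by have -> : p * (beta - n%:R) + (n%:R - beta) * (p - 1) = beta - n%:R;
      [ring|rewrite subr_le0 ltW].
  have p1E : p = 1 by apply/eqP; rewrite eq_le p1.
  exists 1 => //; have /andP[_ gn] := gamma_p_eq1 p1E.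
  have bE : beta = gamma by move: betaE; rewrite p1E; lra.
  by rewrite p1E bE; lra.
have alphan : 0 < alpha <= p * n%:R.
  by case/andP: alpha_bounds => -> /le_trans; apply; rewrite ler_peMl.
have q0 : 0 <= p * n%:R - alpha by rewrite subr_ge0; case/andP: alphan.
pose M : R := (n.-1 + 1)%:R.
have M1 : 1 <= M by rewrite /M addn1 ler1n.
have M0 : 0 < M by exact: lt_le_trans M1.
pose e t := boundary_point (Y t).
have me x : measurable_fun setT (fun y => `|x - e y|).
  by apply: measurable_fun_row_norm => i; exact: measurable_coord_boundary_sub.
have mF : measurable_fun setT (fun y => `|f y|).
  exact: measurableT_comp.
have vol (rho : R) : 0 < rho ->
    (mu [set y | (`|e y| < rho)%R] <= ((2 * rho) `^ m)%:E)%E.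
  move=> rho0; rewrite -mE; apply: le_trans (vol0 _ rho0).
  rewrite le_eqVlt; apply/orP; left; apply/eqP; congr (mu _).
  by apply/seteqP; split=> y /=; rewrite row_norm_boundary_point.
have goo : (\int[mu]_y
    (`|f y| `^ p * (1 + `|e y|) `^ (- gamma))%:E < +oo)%E.
  have mw : measurable_fun setT
      (fun y => `|f y| `^ p / (1 + enorm (Y y)) `^ gamma).
    have m1e : measurable_fun setT (fun y => 1 + enorm (Y y)).
      apply: measurable_funD; first exact: measurable_cst.
      exact: measurable_fun_enorm.
    under eq_fun do rewrite -powRN.
    apply: measurable_funM; first exact: (measurable_fun_powR mF).
    exact: (measurable_fun_powR m1e).
  have w0 y : 0 <= `|f y| `^ p / (1 + enorm (Y y)) `^ gamma.
    by rewrite divr_ge0 ?powR_ge0.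
  move: f_int; have : (0 <= \int[mu]_y
       (`|f y| `^ p / (1 + enorm (Y y)) `^ gamma)%:E)%E.
    by apply: integral_ge0 => y _; rewrite lee_fin.
  case I : (\int[mu]_y _)%E => [I0||] // _ _.
  apply: (@le_lt_trans _ _ (M `^ `|- gamma| * I0)%:E); last exact: ltry.
  have me0 : measurable_fun setT (fun y => `|e y|).
    have := me 0; congr measurable_fun.
    by apply/funext => y; rewrite sub0r normrN.
  apply: (@ge0_integral_le_ptwise _ _ _ (mu) _ _
    (fun y => M `^ `|- gamma| * (`|f y| `^ p / (1 + enorm (Y y)) `^ gamma))) => //.
  - have m1e : measurable_fun setT (fun y => 1 + `|e y|).
      by apply: measurable_funD => //; exact: measurable_cst.
    apply: measurable_funM; first exact: (measurable_fun_powR mF).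
    exact: (measurable_fun_powR m1e).
  - exact: measurable_funM.
  - move=> y _; rewrite mulrCA ler_wpM2l ?powR_ge0// -powRN.
    have s1 := row_norm_le_enorm (Y y); have s2 := enorm_le_row_norm (Y y).
    have mM : n.-1%:R <= M by rewrite /M natrD lerDl.
    have ye : `|e y| = `|Y y| by exact: row_norm_boundary_point.
    have y0 : 0 <= `|Y y| by [].
    have s3 : n.-1%:R * `|Y y| <= M * `|Y y| by rewrite ler_wpM2r.
    have s4 : enorm (Y y) <= M * enorm (Y y) by rewrite ler_peMl ?enorm_ge0.
    rewrite ye; apply: powR_le_comparable => //.
    + by rewrite ltr_wpDr ?enorm_ge0.
    + by rewrite mulrDr mulr1 lerD// (le_trans s1).
    + by rewrite mulrDr mulr1 lerD// (le_trans s2).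
  - by apply: ge0_integral_le_scale; rewrite ?powR_ge0 ?I.
have [x Hx|J [c [rho [cH sumJ Jo]]]] := @potential_little_o _
  T R 'rV[R]_(n.-1 + 1) mu e
  (fun y => `|f y|) m p gamma beta delta n%:R alpha me mF (fun y => normr_ge0 _)
  vol m0 p_ge1 (ler0n _ _) betaE beta0 delta0 betan alphan goo
  (@upper_half_space R n) (@height R n).
  split; [exact: Hx|exact: height_le_row_norm|].
  by move=> y; rewrite -(height_boundary_sub x (Y y)); exact: height_le_row_norm.
exists J, c, (fun j => M * rho j); split.
- by move=> j /cH[cj rj]; split=> //; rewrite mulr_gt0.
- apply: le_lt_trans (esum_scale_lty (powR_ge0 M (p * n%:R - alpha)) _ sumJ);
    last by move=> j _; exact: powR_ge0.
  apply: le_esum => j /cH[cj rj]; rewrite lee_fin.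
  have c0 : 0 < `|c j| by apply: lt_le_trans (height_le_row_norm _); exact: cj.
  rewrite !powRM ?invr_ge0 ?(ltW rj) ?(ltW M0)// -mulrA !ler_wpM2l ?powR_ge0//.
  rewrite -!powRN -powR_inv1 ?(ltW c0)// -powRrM mulN1r !powRN.
  have cM := row_norm_le_enorm (c j).
  rewrite lef_pV2 ?posrE ?powR_gt0// ?(lt_le_trans c0 cM)//.
  by apply: ge0_ler_powR; rewrite ?nnegrE ?enorm_ge0.
move=> eps eps0.
pose s : R := beta - n%:R + alpha / p.
pose K : R := 2 / sphere_area n * M `^ `|s|.
have K0 : 0 <= K.
  apply: mulr_ge0; last exact: powR_ge0.
  by apply: divr_ge0 => //; exact: sphere_area_ge0.
have [r0 r00 H] := Jo (eps / (K + 1)) (divr_gt0 eps0 (ltr_wpDl K0 ltr01)).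
exists (M * r0); first by rewrite mulr_gt0.
move=> x [Hx xJ] xr.
have xM : enorm x <= M * `|x| := enorm_le_row_norm x.
have x0 : 0 < `|x| by apply: lt_le_trans (height_le_row_norm _); exact: Hx.
have xe := row_norm_le_enorm x.
have e0 : 0 < enorm x by exact: lt_le_trans xe.
have Ix : (\int[mu]_y
    (`|f y| * `|x - e y| `^ (- n%:R))%:E <=
    (eps / (K + 1) * (height x `^ (- (alpha / p)) * `|x| `^ s))%:E)%E.
  apply: H => //.
  - move=> j Jj; rewrite leNgt; apply/negP => xc; apply: xJ; exists j => //.
    by apply: le_lt_trans (enorm_le_row_norm _) _; rewrite ltr_pM2l.
  - by rewrite -(ler_pM2l M0) (le_trans xr).
have P0 : 0 <= 2 * height x / sphere_area n.
  by apply: divr_ge0; [rewrite mulr_ge0// ltW|exact: sphere_area_ge0].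
have mk : measurable_fun setT
    (fun y => `|f y| * `|x - e y| `^ (- n%:R)).
  by apply: measurable_funM => //; exact: (measurable_fun_powR (me x)).
have mPf : measurable_fun setT
    (fun y => poisson_kernel x (Y y) * f y).
  by apply: measurable_funM => //; exact: measurable_poisson_kernel.
apply: (@le_trans _ _ (2 * height x / sphere_area n *
    (eps / (K + 1) * (height x `^ (- (alpha / p)) * `|x| `^ s)))).
  apply: normr_Rintegral_le => //.
  apply: (@ge0_integral_le_ptwise _ _ _ (mu) _ _
    (fun y => 2 * height x / sphere_area n *
              (`|f y| * `|x - e y| `^ (- n%:R)))) => //.
  - exact: measurableT_comp.
  - by apply: measurable_funM => //; exact: measurable_cst.
  - move=> y _; rewrite normrM mulrCA mulrC ler_wpM2l//.
    exact: poisson_kernel_le.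
  - by apply: ge0_integral_le_scale => // y; rewrite mulr_ge0 ?powR_ge0.
have xs : `|x| `^ s <= M `^ `|s| * enorm x `^ s.
  by apply: powR_le_comparable => //; apply: le_trans xe _; rewrite ler_peMl ?enorm_ge0.
have sE : gamma / p + (n%:R - 1) * (1 - p^-1) - n%:R + alpha / p = s by [].
rewrite sE.
have -> : height x `^ (1 - alpha / p) = height x * height x `^ (- (alpha / p)).
  by rewrite powRD ?(gt_eqF Hx) ?implybT// powRr1// ltW.
set A := height x `^ _; set B := enorm x `^ s.
have A0 : 0 <= A by exact: powR_ge0.
have B0 : 0 <= B by exact: powR_ge0.
apply: (@le_trans _ _ (K / (K + 1) * (eps * (height x * A * B)))).
  have -> : K / (K + 1) * (eps * (height x * A * B)) =
      2 * height x / sphere_area n * (eps / (K + 1) * (A * (M `^ `|s| * B))).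
    by rewrite /K; ring.
  apply: ler_wpM2l => //; apply: ler_wpM2l; last exact: ler_wpM2l.
  by rewrite divr_ge0 ?addr_ge0// ltW.
rewrite ler_piMl//; last by rewrite ler_pdivrMr ?ltr_wpDl// mul1r lerDl.
by rewrite !mulr_ge0// ltW.
Qed.

Theorem theorem1 (R : realType) (n : nat) (p : R) (q : \bar R)
    (gamma alpha : R) (f : 'rV[R]_n.-1 -> R) (v : 'rV[R]_(n.-1 + 1) -> R)
    (n_ge3 : (3 <= n)%N) (p_ge1 : 1 <= p)
    (pq_conj : (p%:E^-1 + q^-1 = 1)%E)
    (gamma_p_gt1 : 1 < p ->
       - ((n%:R - 1) * (p - 1)) < gamma < (n%:R - 1) + p)
    (gamma_p_eq1 : p = 1 -> 0 < gamma <= n%:R)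
    (alpha_bounds : 0 < alpha <= n%:R)
    (f_meas : measurable_fun [set: lebesgueType R n.-1] f)
    (f_int : (\int[@lebesgue_rV R n.-1]_y
       (`|f y| `^ p / (1 + enorm y) `^ gamma)%:E < +oo)%E)
    (v_def : forall x, upper_half_space x -> v x = poisson_integral f x) :
  exists (J : set nat) (c : nat -> 'rV[R]_(n.-1 + 1)) (rho : nat -> R),
    [/\ forall j, J j -> upper_half_space (c j) /\ 0 < rho j,
        (\esum_(j in J)
           (rho j `^ (p * n%:R - alpha) /
            enorm (c j) `^ (p * n%:R - alpha))%:E < +oo)%E &
        little_o_at_infinity
          (@upper_half_space R n `\` \bigcup_(j in J) eball (c j) (rho j))
          v
          (fun x => height x `^ (1 - alpha / p) *
             enorm x `^ (gamma / p + (n%:R - 1) * fine (q^-1)%E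
                         - n%:R + alpha / p))].
Proof.
have p0 : p != 0 by rewrite gt_eqF// (lt_le_trans ltr01).
have -> : fine (q^-1)%E = 1 - p^-1.
  move: pq_conj; rewrite inver (negPf p0); case: (q^-1)%E => [r||] //= [] <-.
  by rewrite addrAC subrr add0r.
have [||J [c [rho [cH sumJ Jo]]]] := poisson_integral_little_o
  (mu := @lebesgue_rV R n.-1) (Y := id) n_ge3 p_ge1 gamma_p_gt1 gamma_p_eq1
  alpha_bounds _ _ f_meas f_int.
- by move=> j; apply: measurable_fun_lebesgue; exact: measurable_coord_rV.
- by move=> r0 r0_gt0; exact: lebesgue_rV_sup_ball.
exists J, c, rho; split => // eps /Jo[r0 r0_gt0 H]; exists r0 => // x Ax xr0.
by rewrite v_def; [exact: H|case: Ax].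
Qed.
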